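(* A presentation of the group $\Gamma$ is given by the generators $u$, $v$ and $b$ and the relations $$u^3=v^4=b^3=1,\quad (uv)^2=(vu)^2,\quad vb=bv,\quad (buv)^3=(buvu)^2v=1.$$ Here $u,v,b$ are identified with their images in $\Gamma$.
   Context: Let $\zeta=e^{2\pi i/12}$, $r=\zeta+\zeta^{-1}=\sqrt3$, and $$F=\begin{pmatrix}-r-1&1&0\\1&1-r&0\\0&0&1\end{pmatrix}.$$ Let $\Gamma=\{g\in M_{3\times3}(\mathbb Z[\zeta]):g^*Fg=F\}/Z$, where $g^*$ is the conjugate transpose of $g$ and $Z=\{\zeta^\nu I:\nu=0,1,\ldots,11\}$. Elements $gZ$ of $\Gamma$ are denoted by matrix representatives $g$. The following matrices are unitary with respect to $F$ and so define elements of $\Gamma$: $$u=\begin{pmatrix}\zeta^3+\zeta^2-\zeta&1-\zeta&0\\ \zeta^3+\zeta^2-1&\zeta-\zeta^3&0\\0&0&1\end{pmatrix},\quad v=\begin{pmatrix}\zeta^3&0&0\\ \zeta^3+\zeta^2-\zeta-1&1&0\\0&0&1\end{pmatrix},$$ $$b=\begin{pmatrix}1&0&0\\-2\zeta^3-\zeta^2+2\zeta+2&\zeta^3+\zeta^2-\zeta-1&-\zeta^3-\zeta^2\\ \zeta^2+\zeta&-\zeta^3-1&-\zeta^3+\zeta+1\end{pmatrix}.$$ *)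

(* Defs.v *)
From HB Require Import structures.
From Stdlib Require List.
From mathcomp Require Import all_boot all_order all_algebra.
From mathcomp Require Import classical_sets boolp reals trigo.
From mathcomp Require Import complex.
From mathcomp Require Import ring lra.

Set Implicit Arguments.
Unset Strict Implicit.
Unset Printing Implicit Defensive.

Import Order.TTheory GRing.Theory Num.Theory.
Local Open Scope ring_scope.
Local Open Scope complex_scope.
Local Open Scope sesquilinear_scope.
Local Open Scope quotient_scope.

Section Presentation.

Variable X : Type.

(* [(x, true)] stands for the generator x, [(x, false)] for its inverse. *)
Definition word := seq (X * bool).

(* Group congruence on words generated by the pairs in [rels]; the words modulo
   [word_eq rels] form the group <X | w1 = w2 for (w1, w2) in rels>. *)
Inductive word_eq (rels : seq (word * word)) : word -> word -> Prop :=
| word_eq_rel w1 w2 : List.In (w1, w2) rels -> word_eq rels w1 w2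
| word_eq_cancel x e : word_eq rels [:: (x, e); (x, ~~ e)] [::]
| word_eq_cat w1 w2 w3 w4 :
    word_eq rels w1 w2 -> word_eq rels w3 w4 ->
    word_eq rels (w1 ++ w3) (w2 ++ w4)
| word_eq_refl w : word_eq rels w w
| word_eq_sym w1 w2 : word_eq rels w1 w2 -> word_eq rels w2 w1
| word_eq_trans w1 w2 w3 :
    word_eq rels w1 w2 -> word_eq rels w2 w3 -> word_eq rels w1 w3.

Definition word_eval (G : groupType) (gens : X -> G) (w : word) : G :=
  (\prod_(a <- w) (if a.2 then gens a.1 else (gens a.1)^-1))%g.

(* The map x |-> gens x induces an isomorphism <X | rels> -> G. *)
Definition is_presentation (G : groupType) (gens : X -> G)
    (rels : seq (word * word)) : Prop :=
  (forall g : G, exists w, word_eval gens w = g) /\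
  (forall w1 w2, word_eval gens w1 = word_eval gens w2 <-> word_eq rels w1 w2).

Definition word_gen (x : X) : word := [:: (x, true)].

Definition word_exp (w : word) (n : nat) : word := flatten (nseq n w).

End Presentation.

Section Gamma.

Variable R : realType.
Let C := R[i].

(* e ^ (2 pi i / 12) *)
Definition zeta : C := cos (2 * pi / 12) +i* sin (2 * pi / 12).

Definition Zzeta_pred : pred C :=
  fun z => `[< exists p : {poly int}, z = (map_poly intr p).[zeta] >].
Definition Zzeta : {pred C} := Zzeta_pred.

Definition mx3 (s : seq (seq C)) : 'M[C]_3 :=
  \matrix_(i, j) nth 0 (nth [::] s i) j.

Definition F_mx : 'M[C]_3 :=
  let r := zeta + zeta^-1 in
  mx3 [:: [:: - r - 1; 1;     0];
          [:: 1;       1 - r; 0];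
          [:: 0;       0;     1]].

Definition u_mx : 'M[C]_3 :=
  mx3 [:: [:: zeta ^+ 3 + zeta ^+ 2 - zeta; 1 - zeta;         0];
          [:: zeta ^+ 3 + zeta ^+ 2 - 1;    zeta - zeta ^+ 3; 0];
          [:: 0;                            0;                1]].

Definition v_mx : 'M[C]_3 :=
  mx3 [:: [:: zeta ^+ 3;                        0; 0];
          [:: zeta ^+ 3 + zeta ^+ 2 - zeta - 1; 1; 0];
          [:: 0;                                0; 1]].

Definition b_mx : 'M[C]_3 :=
  mx3 [:: [:: 1; 0; 0];
          [:: - 2 * zeta ^+ 3 - zeta ^+ 2 + 2 * zeta + 2;
              zeta ^+ 3 + zeta ^+ 2 - zeta - 1;
              - zeta ^+ 3 - zeta ^+ 2];
          [:: zeta ^+ 2 + zeta; - zeta ^+ 3 - 1; - zeta ^+ 3 + zeta + 1]].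

Definition unitaryF_pred : pred 'M[C]_3 :=
  fun g => (g \is a mxOver Zzeta) && (g^t* *m F_mx *m g == F_mx).

Definition unitaryF := {g : 'M[C]_3 | unitaryF_pred g}.
HB.instance Definition _ := SubChoice.on unitaryF.

Lemma zeta_exp n :
  zeta ^+ n = cos (n%:R * (2 * pi / 12)) +i* sin (n%:R * (2 * pi / 12)).
Proof.
elim: n => [|n IHn]; first by rewrite expr0 mul0r cos0 sin0.
rewrite exprS IHn /zeta; set t := 2 * pi / 12.
rewrite (_ : n.+1%:R * t = t + n%:R * t) ?cosD ?sinD; last first.
  by rewrite -natr1; ring.
by apply/eqP; rewrite eq_complex /=; apply/andP; split; apply/eqP; ring.
Qed.

Lemma zeta6 : zeta ^+ 6 = -1.
Proof.
have -> : -1 = (-1 +i* 0 : C) by apply/eqP; rewrite eq_complex /= oppr0 !eqxx.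
rewrite zeta_exp (_ : 6%:R * (2 * pi / 12) = pi); last by field.
by rewrite cospi sinpi.
Qed.

Lemma zeta4 : zeta ^+ 4 = zeta ^+ 2 - 1.
Proof.
have h : (zeta ^+ 2 + 1) * (zeta ^+ 4 - zeta ^+ 2 + 1) = 0.
  by rewrite -[RHS](subrr (-1)) -{1}zeta6; ring.
move/eqP: h; rewrite mulf_eq0 => /orP[|/eqP h]; last first.
  by apply/eqP; rewrite -subr_eq0 -h; apply/eqP; ring.
move=> h; exfalso; move: h.
rewrite zeta_exp (_ : 2%:R * (2 * pi / 12) = pi / 3); last by field.
rewrite eq_complex /= => /andP[/eqP h _].
have : 0 < cos (pi / 3 : R).
  by apply: cos_gt0_pihalf; have := pi_gt0 R; lra.
by move: h; lra.
Qed.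

Lemma zeta_neq0 : zeta != 0.
Proof.
by apply: contraTneq isT => z0; move: zeta6; rewrite z0 expr0n /= => /esym/eqP;
  rewrite oppr_eq0 oner_eq0.
Qed.

Lemma zeta12 : zeta ^+ 12 = 1.
Proof. by rewrite (exprM _ 6 2) zeta6 sqrrN expr1n. Qed.

Lemma zetaV : zeta^-1 = zeta - zeta ^+ 3.
Proof.
apply: (mulfI zeta_neq0); rewrite divff ?zeta_neq0 //.
by rewrite mulrBr -expr2 -exprS zeta4 opprB addrC subrK.
Qed.

Lemma conj_zeta : zeta^* = zeta^-1.
Proof.
apply: (mulfI zeta_neq0); rewrite divff ?zeta_neq0 // /zeta.
move: (2 * pi / 12) => t; apply/eqP; rewrite eq_complex /=.
by rewrite -(cos2Dsin2 t); apply/andP; split; apply/eqP; ring.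
Qed.


Lemma Zzeta_subring : subring_closed Zzeta.
Proof.
split=> [|x y|x y].
- by apply/asboolP; exists 1; rewrite rmorph1 hornerE.
- move=> /asboolP[p ->] /asboolP[q ->]; apply/asboolP; exists (p - q).
  by rewrite rmorphB !hornerE.
- move=> /asboolP[p ->] /asboolP[q ->]; apply/asboolP; exists (p * q).
  by rewrite rmorphM !hornerE.
Qed.
HB.instance Definition _ :=
  GRing.isSubringClosed.Build C Zzeta_pred Zzeta_subring.

Lemma zeta_Zzeta : zeta \in Zzeta.
Proof. by apply/asboolP; exists 'X; rewrite map_polyX hornerX. Qed.

Lemma zetaV_Zzeta : zeta^-1 \in Zzeta.
Proof. by rewrite zetaV rpredB ?rpredX ?zeta_Zzeta. Qed.

Lemma conj_Zzeta (z : C) : z \in Zzeta -> z^* \in Zzeta.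
Proof.
move=> /asboolP[p ->]; rewrite -(horner_map (@conjc R)) [X in _.[X]]conj_zeta -map_poly_comp.
rewrite horner_coef rpred_sum // => i _.
rewrite rpredM ?rpredX ?zetaV_Zzeta // coef_map_id0 /comp //; last exact: rmorph0.
rewrite [X in X \in _](_ : _ = (p`_i)%:~R :> C); first exact: rpred_int.
exact: rmorph_int.
Qed.

Lemma mx3_over s :
  all (all (fun z => z \in Zzeta)) s -> mx3 s \is a mxOver Zzeta.
Proof.
move=> h; apply/mxOverP => i j; rewrite mxE.
have h0 : 0 \in Zzeta by exact: rpred0.
have [li|li] := ltnP i (size s); last by rewrite [nth [::] s i]nth_default ?nth_nil.
have [lj|lj] := ltnP j (size (nth [::] s i)); last by rewrite nth_default.
by move/all_nthP: h => /(_ [::] i li) /all_nthP h; apply: h.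
Qed.

Lemma adj_over (g : 'M[C]_3) : g \is a mxOver Zzeta -> g^t* \is a mxOver Zzeta.
Proof.
move=> /mxOverP h; apply/mxOverP => i j; rewrite !mxE.
exact: (conj_Zzeta (h j i)).
Qed.

Lemma mul_adj (g h : 'M[C]_3) : (g *m h)^t* = h^t* *m g^t*.
Proof. by rewrite trmx_mul map_mxM. Qed.

Ltac mx3_tac :=
  apply/matrixP; case=> [[|[|[|?]]] //= ?]; case=> [[|[|[|?]]] //= ?];
  rewrite !mxE /= ?(big_ord_recl, big_ord0, mxE) /=.

Lemma F_over : F_mx \is a mxOver Zzeta.
Proof.
apply: mx3_over.
by rewrite /= !(rpred0, rpred1, rpredB, rpredD, rpredN, zeta_Zzeta,
             zetaV_Zzeta).
Qed.

Definition Finv : 'M[C]_3 :=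
  let r := zeta + zeta^-1 in
  mx3 [:: [:: 1 - r; - 1; 0]; [:: - 1; - r - 1; 0]; [:: 0; 0; 1]].

Lemma Finv_over : Finv \is a mxOver Zzeta.
Proof.
apply: mx3_over.
by rewrite /= !(rpred0, rpred1, rpredB, rpredD, rpredN, zeta_Zzeta,
             zetaV_Zzeta).
Qed.

Lemma FinvF : Finv *m F_mx = 1%:M.
Proof.
rewrite /F_mx /Finv /mx3 zetaV; move: zeta4; move: zeta => z z4.
by mx3_tac; ring: z4.
Qed.


Lemma conjC_zeta : Num.conj zeta = zeta - zeta ^+ 3.
Proof. by rewrite -zetaV -conj_zeta. Qed.

Ltac unitary_tac z4 cz :=
  mx3_tac;
  rewrite ?(rmorphB, rmorphD, rmorphN, rmorphM, rmorphXn, rmorph_nat,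
            rmorph0, rmorph1) /= ?cz;
  ring: z4.

Lemma conj_F : F_mx^t* = F_mx.
Proof. 
rewrite /u_mx /v_mx /b_mx /F_mx /mx3 zetaV.
move: zeta4 conjC_zeta; move: zeta => z z4 cz.
by unitary_tac z4 cz. Qed.

Lemma u_unitary : u_mx^t* *m F_mx *m u_mx = F_mx.
Proof. 
rewrite /u_mx /v_mx /b_mx /F_mx /mx3 zetaV.
move: zeta4 conjC_zeta; move: zeta => z z4 cz.
by unitary_tac z4 cz. Qed.

Lemma v_unitary : v_mx^t* *m F_mx *m v_mx = F_mx.
Proof. 
rewrite /u_mx /v_mx /b_mx /F_mx /mx3 zetaV.
move: zeta4 conjC_zeta; move: zeta => z z4 cz.
by unitary_tac z4 cz. Qed.

Lemma b_unitary : b_mx^t* *m F_mx *m b_mx = F_mx.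
Proof. 
rewrite /u_mx /v_mx /b_mx /F_mx /mx3 zetaV.
move: zeta4 conjC_zeta; move: zeta => z z4 cz.
by unitary_tac z4 cz. Qed.

Lemma one_unitary : unitaryF_pred 1%:M.
Proof.
rewrite /unitaryF_pred mxOver_scalar ?rpred0 ?rpred1 //=.
by rewrite trmx1 map_mx1 mul1mx mulmx1.
Qed.

Lemma mul_unitary (g h : 'M[C]_3) :
  unitaryF_pred g -> unitaryF_pred h -> unitaryF_pred (g *m h).
Proof.
move=> /andP[og /eqP ug] /andP[oh /eqP uh]; rewrite /unitaryF_pred.
rewrite mxOverM //= mul_adj -!mulmxA [F_mx *m _]mulmxA [g^t* *m _]mulmxA.
by rewrite [g^t* *m _]mulmxA ug mulmxA uh.
Qed.

Definition inv_mx (g : 'M[C]_3) : 'M[C]_3 := Finv *m g^t* *m F_mx.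

Lemma mul_inv_mx g : unitaryF_pred g -> inv_mx g *m g = 1%:M.
Proof.
by case/andP=> _ /eqP ug; rewrite /inv_mx -!mulmxA [g^t* *m _]mulmxA ug FinvF.
Qed.

Lemma inv_unitary g : unitaryF_pred g -> unitaryF_pred (inv_mx g).
Proof.
move=> ug; have ig := mulmx1C (mul_inv_mx ug).
case/andP: ug => og /eqP ug; rewrite /unitaryF_pred.
rewrite !mxOverM ?Finv_over ?F_over ?adj_over //=; apply/eqP.
move: (inv_mx g) ig => h ig; rewrite -[in LHS]ug !mulmxA -mul_adj ig trmx1 map_mx1 mul1mx.
by rewrite -mulmxA ig mulmx1.
Qed.

Definition mulU (x y : unitaryF) : unitaryF :=
  exist _ (val x *m val y) (mul_unitary (valP x) (valP y)).
Definition oneU : unitaryF := exist _ 1%:M one_unitary.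
Definition invU (x : unitaryF) : unitaryF :=
  exist _ (inv_mx (val x)) (inv_unitary (valP x)).

Fact mulUA : associative mulU.
Proof. by move=> x y z; apply/val_inj; rewrite /= mulmxA. Qed.
Fact mul1U : left_id oneU mulU.
Proof. by move=> x; apply/val_inj; rewrite /= mul1mx. Qed.
Fact mulU1 : right_id oneU mulU.
Proof. by move=> x; apply/val_inj; rewrite /= mulmx1. Qed.
Fact mulVU : left_inverse oneU invU mulU.
Proof. by move=> x; apply/val_inj; apply: mul_inv_mx (valP x). Qed.
Fact mulUV : right_inverse oneU invU mulU.
Proof. by move=> x; apply/val_inj; apply/mulmx1C/mul_inv_mx/valP. Qed.
HB.instance Definition _ :=
  isGroup.Build unitaryF mulUA mul1U mulU1 mulVU mulUV.

(* x and y lie in the same coset of Z = {zeta ^ nu I : nu = 0, ..., 11}. *)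
Definition eqmodZ : rel unitaryF :=
  fun x y => [exists nu : 'I_12, val x == (zeta ^+ nu)%:M *m val y].

Lemma eqmodZP x y :
  reflect (exists n, val x = zeta ^+ n *: val y) (eqmodZ x y).
Proof.
apply: (iffP existsP) => [[nu /eqP ->]|[n ->]].
  by exists nu; rewrite mul_scalar_mx.
exists (inord (n %% 12)); rewrite inordK ?ltn_mod // mul_scalar_mx.
by rewrite {1}(divn_eq n 12) exprD mulnC exprM zeta12 expr1n mul1r.
Qed.

Lemma eqmodZ_refl : reflexive eqmodZ.
Proof. by move=> x; apply/eqmodZP; exists 0; rewrite expr0 scale1r. Qed.

Lemma eqmodZ_sym : symmetric eqmodZ.
Proof.
have h x y : eqmodZ x y -> eqmodZ y x.
  case/existsP=> nu /eqP e; apply/eqmodZP; exists (12 - nu)%N.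
  rewrite e mul_scalar_mx scalerA -exprD subnK ?zeta12 ?scale1r //.
  by rewrite ltnW.
by move=> x y; apply/idP/idP; apply: h.
Qed.

Lemma eqmodZ_trans : transitive eqmodZ.
Proof.
move=> y x z /eqmodZP[n exy] /eqmodZP[m eyz]; apply/eqmodZP.
by exists (n + m)%N; rewrite exy eyz scalerA -exprD.
Qed.

Canonical eqmodZ_equiv := EquivRel eqmodZ eqmodZ_refl eqmodZ_sym eqmodZ_trans.

Definition Gamma := {eq_quot eqmodZ}.
HB.instance Definition _ := Choice.on Gamma.
HB.instance Definition _ := EqQuotient.on Gamma.

Definition mulG : Gamma -> Gamma -> Gamma := lift_op2 Gamma (fun x y => x * y)%g.
Definition oneG : Gamma := lift_cst Gamma 1%g.
Definition invG : Gamma -> Gamma := lift_op1 Gamma (fun x => x^-1)%g.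

Lemma pi_mulG : {morph \pi_Gamma : x y / (x * y)%g >-> mulG x y}.
Proof.
move=> x y; unlock mulG; apply/eqP; rewrite piE; apply/eqmodZP.
have /eqmodZP[n ex] : eqmodZ x (repr (\pi_Gamma x)) by rewrite -eqmodE reprK.
have /eqmodZP[m ey] : eqmodZ y (repr (\pi_Gamma y)) by rewrite -eqmodE reprK.
exists (n + m)%N; rewrite /= ex ey.
by rewrite -scalemxAl -scalemxAr scalerA exprD.
Qed.
Canonical pi_mulG_morph := PiMorph2 pi_mulG.

Canonical pi_oneG_morph := PiConst oneG.

Lemma pi_invG : {morph \pi_Gamma : x / x^-1%g >-> invG x}.
Proof.
move=> x; unlock invG; apply/eqP; rewrite piE; apply/eqmodZP.
set y := repr _.
have /eqmodZP[n e] : eqmodZ y x by rewrite -eqmodE reprK.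
exists n; rewrite /=.
have h : (val x *m inv_mx (val x)) = 1%:M := congr1 val (mulUV x).
have h' : (inv_mx (val y) *m val y) = 1%:M := congr1 val (mulVU y).
by rewrite -[LHS]mul1mx -h' e -scalemxAr -!scalemxAl -mulmxA h mulmx1 -e.
Qed.
Canonical pi_invG_morph := PiMorph1 pi_invG.

Fact mulGA : associative mulG.
Proof. by do 3![elim/quotW=> ?]; rewrite !piE mulgA. Qed.
Fact mul1G : left_id oneG mulG.
Proof. by elim/quotW=> x; rewrite !piE mul1g. Qed.
Fact mulG1 : right_id oneG mulG.
Proof. by elim/quotW=> x; rewrite !piE mulg1. Qed.
Fact mulVG : left_inverse oneG invG mulG.
Proof. by elim/quotW=> x; rewrite !piE mulVg. Qed.
Fact mulGV : right_inverse oneG invG mulG.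
Proof. by elim/quotW=> x; rewrite !piE mulgV. Qed.
HB.instance Definition _ := isGroup.Build Gamma mulGA mul1G mulG1 mulVG mulGV.

Fact u_mxP : unitaryF_pred u_mx.
Proof.
rewrite /unitaryF_pred u_unitary eqxx andbT mx3_over //=.
by rewrite !(rpred0, rpred1, rpredB, rpredD, rpredN, rpredX, rpredM,
             rpred_nat, zeta_Zzeta).
Qed.

Fact v_mxP : unitaryF_pred v_mx.
Proof.
rewrite /unitaryF_pred v_unitary eqxx andbT mx3_over //=.
by rewrite !(rpred0, rpred1, rpredB, rpredD, rpredN, rpredX, rpredM,
             rpred_nat, zeta_Zzeta).
Qed.

Fact b_mxP : unitaryF_pred b_mx.
Proof.
rewrite /unitaryF_pred b_unitary eqxx andbT mx3_over //=.
by rewrite !(rpred0, rpred1, rpredB, rpredD, rpredN, rpredX, rpredM,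
             rpred_nat, zeta_Zzeta).
Qed.

Definition gamma_u : Gamma := \pi_Gamma (exist _ u_mx u_mxP : unitaryF).
Definition gamma_v : Gamma := \pi_Gamma (exist _ v_mx v_mxP : unitaryF).
Definition gamma_b : Gamma := \pi_Gamma (exist _ b_mx b_mxP : unitaryF).

End Gamma.

Inductive generator := gen_u | gen_v | gen_b.

Definition generator_val (R : realType) (x : generator) : Gamma R :=
  match x with
  | gen_u => gamma_u R
  | gen_v => gamma_v R
  | gen_b => gamma_b R
  end.

(* Main.v *)
(* The height of g in Gamma is |g_33|^2. It is at least 1 and depends only on the coset g K,
   where K is the subgroup generated by u and v; since the form F is definite after the
   conjugation sqrt 3 |-> - sqrt 3, distinct heights differ by at least 1. The relations
   u^3 = v^4 = 1 and (uv)^2 = (vu)^2 alone give every element of K a normal form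
   d_j (uv)^(2n) v^m with 6 * 12 * 4 = 288 possibilities, which the matrices tell apart.

   As v commutes with b, a coset g K has the 72 neighbours g d_j (uv)^(2n) b K. Call an
   element descending if it is reached from K through neighbours of increasing height. The
   relations b^3 = (buv)^3 = (buvu)^2 v = 1 produce triangles of neighbours, and they allow
   a peak to be lowered: any two neighbours of g K not above g K are joined by a chain of
   neighbours strictly below g K. Hence every element of the presented group is
   descending. One whose image in Gamma is trivial has the height of 1, so that it lies in
   K, where normal forms show that it is trivial.

   Which neighbours of g K can be not above g K, once the coset is turned so that neighbour
   (0, 0) is the lowest? All but ten adjacent and eight far ones are excluded because a
   combination of the Hermitian forms giving the heights is positive definite; a far one
   comes with a lower common neighbour of the two.

   The group Gamma is generated by u, v, b because a coset of height at least 2 has a lower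
   neighbour (the six d_j correspond to the vertices of an octahedron), while the elements
   of height 1 are found by enumeration. *)

Require Import Defs.
From HB Require Import structures.
From Stdlib Require List.
From Stdlib Require Import ZArith.
From mathcomp Require Import all_boot all_order all_algebra.
From mathcomp Require Import ssrZ zify ring lra.
From mathcomp Require Import boolp reals trigo complex.

Set Implicit Arguments.
Unset Strict Implicit.
Unset Printing Implicit Defensive.

Import Order.TTheory GRing.Theory Num.Theory.

(** * Groups given by presentations *)

Section PresentedGroup.
Variables (X : choiceType) (rels : seq (word X * word X)).

Definition word_rel : rel (word X) :=
  fun w1 w2 => boolp.asbool (word_eq rels w1 w2).

Lemma word_relP w1 w2 : reflect (word_eq rels w1 w2) (word_rel w1 w2).
Proof. exact: boolp.asboolP. Qed.

Lemma word_rel_refl : reflexive word_rel.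
Proof. by move=> w; apply/word_relP; apply: word_eq_refl. Qed.

Lemma word_rel_sym : symmetric word_rel.
Proof.
by move=> w1 w2; apply/word_relP/word_relP; apply: word_eq_sym.
Qed.

Lemma word_rel_trans : transitive word_rel.
Proof.
move=> w2 w1 w3 /word_relP h1 /word_relP h2; apply/word_relP.
exact: word_eq_trans h1 h2.
Qed.

Canonical word_rel_equiv :=
  EquivRel word_rel word_rel_refl word_rel_sym word_rel_trans.

Definition presented := {eq_quot word_rel}%qT.
HB.instance Definition _ := Choice.on presented.
HB.instance Definition _ := EqQuotient.on presented.

Definition word_class (w : word X) : presented := \pi_presented%qT w.

Lemma word_classP w1 w2 : word_class w1 = word_class w2 <-> word_eq rels w1 w2.
Proof.
split=> [/eqP|h]; last by apply/eqP; rewrite /word_class eqmodE; apply/word_relP.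
by rewrite /word_class eqmodE => /word_relP.
Qed.

Definition word_inv (w : word X) : word X :=
  rev [seq (a.1, ~~ a.2) | a <- w].

Lemma word_invl w : word_eq rels (word_inv w ++ w) [::].
Proof.
elim: w => [|[x e] w IHw]; first exact: word_eq_refl.
rewrite /word_inv /= rev_cons cat_rcons; apply: word_eq_trans IHw.
apply: word_eq_cat; first exact: word_eq_refl.
rewrite -cat1s -[(x, e) :: w]cat1s catA -[X in word_eq _ _ X]cat0s.
apply: word_eq_cat; last exact: word_eq_refl.
by rewrite -{2}[e]negbK; apply: word_eq_cancel.
Qed.

Lemma word_invr w : word_eq rels (w ++ word_inv w) [::].
Proof.
elim/last_ind: w => [|w [x e] IHw]; first exact: word_eq_refl.
rewrite /word_inv map_rcons rev_rcons cat_rcons; apply: word_eq_trans IHw.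
apply: word_eq_cat; first exact: word_eq_refl.
rewrite -cat1s -[(x, ~~ e) :: _]cat1s catA -[X in word_eq _ _ X]cat0s.
apply: word_eq_cat; last exact: word_eq_refl.
exact: word_eq_cancel.
Qed.

Lemma class_repr w : word_eq rels (repr (word_class w)) w.
Proof. by apply/word_classP; rewrite /word_class reprK. Qed.

Lemma repr_class (g : presented) : word_class (repr g) = g.
Proof. exact: reprK. Qed.

Definition presented_mul (g h : presented) := word_class (repr g ++ repr h).
Definition presented_inv (g : presented) := word_class (word_inv (repr g)).

Lemma class_cat w1 w2 :
  word_class (w1 ++ w2) = presented_mul (word_class w1) (word_class w2).
Proof.
by apply/word_classP/word_eq_sym/word_eq_cat; apply: class_repr.
Qed.

Fact presented_mulA : associative presented_mul.
Proof.
move=> g h k; rewrite -[g]repr_class -[h]repr_class -[k]repr_class.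
by rewrite -!class_cat catA.
Qed.
Fact presented_mul1 : left_id (word_class [::]) presented_mul.
Proof. by move=> g; rewrite -[g]repr_class -class_cat. Qed.
Fact presented_mulr1 : right_id (word_class [::]) presented_mul.
Proof. by move=> g; rewrite -[g]repr_class -class_cat cats0. Qed.
Fact presented_mulV : left_inverse (word_class [::]) presented_inv presented_mul.
Proof.
move=> g; rewrite -{2}[g]repr_class -class_cat.
by apply/word_classP/word_invl.
Qed.
Fact presented_mulrV :
  right_inverse (word_class [::]) presented_inv presented_mul.
Proof.
move=> g; rewrite -{1}[g]repr_class -class_cat.
by apply/word_classP/word_invr.
Qed.
HB.instance Definition _ := isGroup.Build presented
  presented_mulA presented_mul1 presented_mulr1 presented_mulV presented_mulrV.

Lemma class_mul w1 w2 :
  word_class (w1 ++ w2) = (word_class w1 * word_class w2)%g.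
Proof. exact: class_cat. Qed.

Lemma class_one : word_class [::] = 1%g.
Proof. by []. Qed.

Lemma word_eval_class w :
  word_eval (fun x => word_class (word_gen x)) w = word_class w.
Proof.
rewrite /word_eval; elim: w => [|[x e] w IHw]; first by rewrite big_nil.
rewrite big_cons IHw -[(x, e) :: w]cat1s class_mul; congr (_ * _)%g.
case: e => //=; apply: (@mulgI _ (word_class (word_gen x))).
by rewrite mulgV -class_mul; apply/esym/word_classP/(word_eq_cancel _ x true).
Qed.

End PresentedGroup.

(** * Normal forms in the subgroup generated by u and v *)

(* [true] stands for u and [false] for v. *)
Definition kinv (s : seq bool) : seq bool :=
  flatten [seq (if x then nseq 2 true else nseq 3 false) | x : bool <- rev s].

(** The words d_0, ..., d_5, one for each coset in K of the subgroup generated by the central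
    element (uv)^2 and v. *)
Definition coset_words : seq (seq bool) :=
  [:: [::]; [:: true]; [:: true; true]; [:: false; true; true];
      [:: false; false; true; true]; [:: true; false; false; true; true]].

(* With d_j the j-th coset word and z = (uv)^2, the entry (k, a, c) at j says
   u d_j = d_k z^a v^c, respectively v d_j = d_k z^a v^c. *)
Definition u_table : seq (nat * nat * nat) :=
  [:: (1, 0, 0); (2, 0, 0); (0, 0, 0); (4, 2, 3); (5, 0, 0); (3, 10, 1)].
Definition v_table : seq (nat * nat * nat) :=
  [:: (0, 0, 1); (2, 1, 3); (3, 0, 0); (4, 0, 0); (1, 11, 1); (5, 3, 3)].

Definition nf_step (x : bool) (t : nat * nat * nat) : nat * nat * nat :=
  let: (j, n, m) := t in
  let: (k, a, c) := nth (0, 0, 0) (if x then u_table else v_table) j in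
  (k, (a + n) %% 12, (c + m) %% 4).

Definition nf (s : seq bool) : nat * nat * nat := foldr nf_step (0, 0, 0) s.

Definition coset_word (e : nat * nat) : seq bool :=
  nth [::] coset_words e.1 ++ flatten (nseq e.2 [:: true; false; true; false]).

Definition vword (m : nat) : seq bool := nseq m false.

Lemma nf_bound s : [&& (nf s).1.1 < 6, (nf s).1.2 < 12 & (nf s).2 < 4].
Proof.
elim: s => [//|x s]; rewrite /= /nf_step; case: (nf s) => [[j n] m] /=.
case/and3P=> j6 _ _; case E: (nth _ _ _) => [[k a] c] /=.
rewrite !ltn_mod andbT.
by move: E; case: x; case: j j6 => [|[|[|[|[|[|]]]]]] //= _ [<- _ _].
Qed.

Ltac gnorm := rewrite ?(expgS, expg0, mulg1, mulgA).

Section KWords.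
Local Open Scope group_scope.
Variables (G : groupType) (u v : G).

Definition kev (s : seq bool) : G :=
  \prod_(x <- s) (if x then u else v).

Lemma kev_nil : kev [::] = 1. Proof. exact: big_nil. Qed.

Lemma kev_cons x s : kev (x :: s) = (if x then u else v) * kev s.
Proof. exact: big_cons. Qed.

Lemma kev_cat s t : kev (s ++ t) = kev s * kev t.
Proof. exact: big_cat. Qed.

Lemma kev_vword m : kev (vword m) = v ^+ m.
Proof.
by elim: m => [|m IHm]; rewrite ?kev_nil // kev_cons IHm expgS.
Qed.

Hypotheses (u3 : u ^+ 3 = 1) (v4 : v ^+ 4 = 1).
Hypothesis uv_braid : u * v * u * v = v * u * v * u.

Lemma kev_inv s : kev (kinv s) = (kev s)^-1.
Proof.
rewrite /kinv; elim: s => [|x s IHs]; first by rewrite kev_nil invg1.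
rewrite rev_cons map_rcons flatten_rcons kev_cat IHs kev_cons invgM; congr (_ * _).
apply: (@mulIg _ (if x then u else v)); rewrite mulVg.
by case: x; rewrite !kev_cons kev_nil mulg1; [rewrite -u3 | rewrite -v4]; gnorm.
Qed.

End KWords.

(** * The multiplication table of the coset words *)

Section KTable.
Local Open Scope group_scope.
Variables (G : groupType) (u v z : G).
Hypotheses (zE : z = u * v * u * v) (zE' : z = v * u * v * u).
Hypotheses (uuu : forall x, x * u * u * u = x)
  (vvvv : forall x, x * v * v * v * v = x).

Let zu : commute z u. Proof. by rewrite /commute {1}zE zE' !mulgA. Qed.
Let zv : commute z v. Proof. by rewrite /commute {1}zE' zE !mulgA. Qed.
Let cu x : x * u * z = x * z * u. Proof. by rewrite -mulgA -zu mulgA. Qed.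
Let cv x : x * v * z = x * z * v. Proof. by rewrite -mulgA -zv mulgA. Qed.

(** From z = uvuv one has vuv = u^-1 z with u^-1 = u^2. The prefix [x] lets the rule fire inside a
    left-associated product. *)
Let vuv x : x * v * u * v = x * z * u * u.
Proof. by rewrite -!cu zE !mulgA uuu. Qed.

Let uvu x : x * u * v * u = x * z * v * v * v.
Proof. by rewrite -[LHS]vvvv zE !mulgA. Qed.

Let d5 := u * v * v * u * u.

Lemma table_v5 : v * d5 = d5 * z * z * z * v * v * v.
Proof.
rewrite /d5 -[LHS]mul1g -[RHS]mul1g !mulgA !(cu, cv).
rewrite vuv (uvu (1 * z * u)) cu -(cu (1 * z * z)) -(cv (1 * z * z * u)).
by rewrite -(cv (1 * z * z * u * v)) -(vuv (1 * z * z * u * v * v)) vvvv.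
Qed.

(** By [table_v5], v is conjugate under [d5] to z^3 v^3. As z is central, fourth powers give 1 =
    z^12 v^12 = z^12. *)
Lemma table_z12 : z ^+ 12 = 1.
Proof.
pose w := z ^+ 3 * v ^+ 3.
have hw : v * d5 = d5 * w by rewrite table_v5 /w !expgS !expg0 !mulg1 !mulgA.
have h n : v ^+ n * d5 = d5 * w ^+ n.
  elim: n => [|n IHn]; first by rewrite mul1g mulg1.
  by rewrite expgSr -(mulgA _ v) hw mulgA IHn -mulgA -expgSr.
have v4 : v ^+ 4 = 1 by rewrite -[LHS]mul1g !expgS expg0 mulg1 !mulgA vvvv.
have := h 4; rewrite v4 mul1g expgMn; last exact: commuteX2.
rewrite -!expgnA (mulnC 3 4) (expgnA v) v4 expg1n mulg1.
by rewrite -{1}[d5]mulg1 => /mulgI.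
Qed.

Let norm1 (x y : G) : 1 * x = 1 * y -> x = y. Proof. by rewrite !mul1g. Qed.

(** Here u v u^2 = z v^-1 u, and v^-1 u = v^2 (vuv) v^-1 with vuv = z u^2. *)
Lemma table_u3 : u * (v * u * u) = v * v * u * u * z * z * v * v * v.
Proof.
apply: norm1; rewrite !mulgA uvu !(cu, cv).
rewrite -(cv (1 * z)) -(cv (1 * z * v)) -(vuv (1 * z * v * v)) vvvv.
by [].
Qed.

Let z11 : z ^+ 11 = z^-1.
Proof. by apply: (@mulIg _ z); rewrite -expgSr table_z12 mulVg. Qed.
Let z10 : z ^+ 10 = z^-1 * z^-1.
Proof. by apply: (@mulIg _ z); rewrite -expgSr z11 mulgVK. Qed.

(** Multiplying [table_u3] by u^2 on the left and by v on the right gives v u^2 v = z^2 u d_5; then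
    z^10 = z^-2. *)
Lemma table_u5 : u * d5 = v * u * u * z ^+ 10 * v.
Proof.
have h : z * z * (u * d5) = v * u * u * v.
  have -> : v * u * u * v = u * u * (u * (v * u * u) * v).
    by rewrite !mulgA -[RHS]mul1g !mulgA uuu mul1g.
  rewrite table_u3 /d5 -[LHS]mul1g -[RHS]mul1g !mulgA vvvv !(cu, cv).
  by [].
have c : commute (v * u * u) (z ^+ 10).
  by apply/commuteX/commute_sym; do 2?apply: commuteM.
by rewrite c z10 -[RHS](mulgA (z^-1 * z^-1)) -h -!mulgA !mulKg.
Qed.

Lemma table_v4 : v * (v * v * u * u) = u * z ^+ 11 * v.
Proof.
have h : z * (v * (v * v * u * u)) = u * v.
  by rewrite !mulgA -[LHS]mul1g !mulgA -uvu uuu mul1g.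
have [cVu cVv] : commute u z^-1 /\ commute v z^-1.
  by split; apply/commuteV/commute_sym.
by rewrite z11 cVu -[RHS]mulgA -h mulKg.
Qed.

End KTable.

Section KNormalForm.
Local Open Scope group_scope.
Variables (G : groupType) (u v : G).
Hypotheses (u3 : u ^+ 3 = 1) (v4 : v ^+ 4 = 1).
Hypothesis uv_braid : u * v * u * v = v * u * v * u.

Let uuu x : x * u * u * u = x.
Proof. by rewrite -!mulgA -{2}[x]mulg1 -u3 !expgS expg0 mulg1. Qed.
Let vvvv x : x * v * v * v * v = x.
Proof. by rewrite -!mulgA -{2}[x]mulg1 -v4 !expgS expg0 mulg1. Qed.

Definition nf_val (t : nat * nat * nat) : G :=
  kev u v (nth [::] coset_words t.1.1) * (u * v * u * v) ^+ t.1.2 * v ^+ t.2.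

Lemma expg_modn (x : G) n m : x ^+ n = 1 -> x ^+ (m %% n) = x ^+ m.
Proof.
by move=> xn; rewrite [in RHS](divn_eq m n) expgnDr mulnC expgnA xn expg1n mul1g.
Qed.

Lemma central_exp12 : (u * v * u * v) ^+ 12 = 1.
Proof. exact: (@table_z12 _ u v). Qed.

(** After the table entry is inserted, centrality of (uv)^2 merges the exponents, which may be
    reduced modulo 12 and 4. *)
Lemma nf_step_val x t : t.1.1 < 6 ->
  nf_val (nf_step x t) = (if x then u else v) * nf_val t.
Proof.
case: t => [[j n] m] /= j6.
have [zu zv] : commute (u * v * u * v) u /\ commute (u * v * u * v) v.
  by split; rewrite /commute; [rewrite {2}uv_braid|rewrite {1}uv_braid]; rewrite !mulgA.
have T j' : j' < 6 -> forall k a c,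
  nth (0, 0, 0) (if x then u_table else v_table) j' = (k, a, c) ->
  (if x then u else v) * kev u v (nth [::] coset_words j') =
  kev u v (nth [::] coset_words k) * (u * v * u * v) ^+ a * v ^+ c.
  (* An opaque [z] keeps [mulgA] from spreading out (uv)^2. *)
  have [z zE] : exists z, z = u * v * u * v by exists (u * v * u * v).
  have zE' := etrans zE uv_braid.
  have t3 := table_u3 zE zE' uuu vvvv; have t5 := table_u5 zE zE' uuu vvvv.
  have t4 := table_v4 zE zE' uuu vvvv; have t5' := table_v5 zE zE' uuu vvvv.
  have t1 : v * u = u * u * z * v * v * v.
    by rewrite -[LHS]vvvv zE -[RHS]mul1g !mulgA uuu mul1g.
  have t2 : u * u * u = 1 by rewrite -[LHS]mul1g !mulgA uuu.
  rewrite -zE; case: x; case: j' => [|[|[|[|[|[|]]]]]] //= _ k a c [<- <- <-] /=;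
    by rewrite ?(kev_cons, kev_nil) /= ?expg0 ?expg1 ?mulg1 ?mul1g // ?mulgA // -?zE //;
       move: t3 t5 t4 t5'; rewrite ?mulgA.
case E: (nth _ _ _) => [[k a] c] /=; rewrite /nf_val /=.
rewrite (expg_modn _ central_exp12) (expg_modn _ v4) !mulgA (T _ j6 _ _ _ E).
rewrite !expgnDr !mulgA; congr (_ * _).
rewrite -[LHS]mulgA -[RHS]mulgA; congr (_ * _).
exact: commuteX2.
Qed.

Lemma nfP s : kev u v s = nf_val (nf s).
Proof.
elim: s => [|x s IHs]; first by rewrite /nf_val /= kev_nil !mulg1.
rewrite (_ : nf (x :: s) = nf_step x (nf s)) // nf_step_val -?IHs ?kev_cons //.
by case/and3P: (nf_bound s).
Qed.

Lemma kev_coset_word e : kev u v (coset_word e) = nf_val (e, 0).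
Proof.
rewrite /coset_word kev_cat /nf_val /= mulg1; congr (_ * _).
elim: e.2 => [|n IHn] /=; rewrite ?kev_nil // !kev_cons IHn expgS /=.
by rewrite !mulgA.
Qed.

End KNormalForm.

(** * Descent along heights *)

Lemma exists_min (T : Type) (f : T -> nat) (x0 : T) :
  exists x, forall y, f x <= f y.
Proof.
have [n] := ubnP (f x0); elim: n x0 => // n IHn x0 le_n.
have [[x lt_x]|nlt] := EM (exists x, f x < f x0).
  by apply: (IHn x); apply: leq_trans lt_x le_n.
by exists x0 => y; rewrite leqNgt; apply/negP => lt_y; apply: nlt; exists y.
Qed.

(* [(j, n)] is the index of d_j (uv)^(2n); these are the neighbours of (0, 0). *)
Definition neighbours : seq (nat * nat) :=
  [:: (0, 1); (0, 11); (1, 0); (1, 11); (2, 0); (2, 1);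
      (3, 0); (3, 1); (4, 0); (4, 1)].

Definition adjacent (s : seq bool) : bool := (nf s).1 \in neighbours.

Definition edge_words : seq (seq bool) :=
  [:: [:: true; false; true]; kinv [:: true; false; true];
      [:: true]; kinv [:: true]].

Section Descent.
Local Open Scope group_scope.
Variables (G : groupType) (u v b : G).
Hypotheses (u3 : u ^+ 3 = 1) (v4 : v ^+ 4 = 1) (b3 : b ^+ 3 = 1).
Hypothesis uv_braid : u * v * u * v = v * u * v * u.
Hypothesis vb : commute v b.
Hypothesis buv3 : (b * u * v) ^+ 3 = 1.
Hypothesis buvu2 : (b * u * v * u) ^+ 2 * v = 1.

Local Notation K := (kev u v).

Let KV s : K (kinv s) = (K s)^-1. Proof. exact: kev_inv. Qed.

(* Of the cosets g K, g b K and g k b K, any two are then neighbours. *)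
Definition triangle (k : G) : Prop :=
  exists p q, k * b = b * K p * b * K q.

Let uvu := [:: true; false; true].
Let uvuv := [:: true; false; true; false].

(** Expanding (buvu)^2 v = 1 gives b (uvu) b (uvuv) = 1. *)
Let buvub : b * K uvu * b = (K uvuv)^-1.
Proof.
apply: (@mulIg _ (K uvuv)).
by rewrite mulVg -buvu2 expg2 !kev_cons kev_nil !mulg1 !mulgA.
Qed.

(** Thus b^-1 lies in K b K, which makes the neighbour relation on cosets symmetric. *)
Let bV : b^-1 = K uvu * b * K uvuv.
Proof. apply: mulg1_eq; rewrite !mulgA.  by rewrite buvub mulVg. Qed.

Let bb : b * b = b^-1.
Proof. by apply: (@mulIg _ b); rewrite mulVg -b3 !expgS expg0 mulg1 mulgA. Qed.

Lemma triangle_uvu : triangle (K uvu).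
Proof.
exists [::], (kinv uvuv).
by rewrite kev_nil mulg1 bb bV KV -!mulgA mulgV mulg1.
Qed.

(** With k = uv, the relation (buv)^3 = 1 reads bkbk = k^-1 b^-1, and [bV] turns the right side into
    u b k^2; hence u b = b k b k^-1. *)
Lemma triangle_u : triangle (K [:: true]).
Proof.
exists [:: true; false], (kinv [:: true; false]).
rewrite KV; set k := K [:: true; false].
have kE : k = u * v by rewrite /k !kev_cons kev_nil mulg1.
have h : b * k * (b * k) = (b * k)^-1.
  apply: (@mulIg _ (b * k)); rewrite mulVg kE (mulgA b) -buv3.
  by rewrite !expgS expg0 mulg1 !mulgA.
apply: (@mulIg _ k); rewrite -[RHS]mulgA mulVg mulg1.
apply: (@mulIg _ k); rewrite -[RHS](mulgA (b * k)) h invgM bV.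
have -> : k^-1 * (K uvu * b * K uvuv) = u * b * k * k.
  have -> : K uvu = k * u by rewrite kE !kev_cons kev_nil !mulg1 !mulgA.
  have -> : K uvuv = k * k by rewrite kE !kev_cons kev_nil !mulg1 !mulgA.
  by rewrite !mulgA mulVg mul1g.
by rewrite kev_cons kev_nil mulg1.
Qed.

(** From k b = b p b q one gets k^-1 b = b q^-1 b^-1 p^-1, and [bV] expands the inner b^-1. *)
Lemma triangle_inv k : triangle k -> triangle k^-1.
Proof.
move=> [p [q h]]; exists (kinv q ++ uvu), (uvuv ++ kinv p).
rewrite !kev_cat !KV.
have -> : b * ((K q)^-1 * K uvu) * b * (K uvuv * (K p)^-1) =
   b * (K q)^-1 * (K uvu * b * K uvuv) * (K p)^-1 by rewrite !mulgA.
rewrite -bV; apply: (@mulgI _ k); rewrite mulgA mulgV mul1g !mulgA h.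
by rewrite mulgK mulgK mulgK.
Qed.

Let vXb n : v ^+ n * b = b * v ^+ n.
Proof. exact/commute_sym/commuteX/commute_sym. Qed.

Lemma triangle_vl n k : triangle k -> triangle (v ^+ n * k).
Proof.
move=> [p [q h]]; exists (vword n ++ p), q.
by rewrite -mulgA h kev_cat kev_vword !mulgA vXb.
Qed.

Lemma triangle_vr n k : triangle k -> triangle (k * v ^+ n).
Proof.
move=> [p [q h]]; exists p, (q ++ vword n).
by rewrite -mulgA vXb mulgA h kev_cat kev_vword !mulgA.
Qed.

Let nfK s : K s = nf_val u v (nf s). Proof. exact: nfP. Qed.

Lemma nf_eq1 s t : (nf s).1 = (nf t).1 -> exists n, K s = K t * v ^+ n.
Proof.
(* The term [3 * (nf t).2] stands for the negative exponent, as v^4 = 1. *)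
move=> e; exists (3 * (nf t).2 + (nf s).2); rewrite !nfK /nf_val e -!mulgA.
congr (_ * (_ * _)); rewrite -expgnDr addnA -mulSn expgnDr expgnA v4.
by rewrite expg1n mul1g.
Qed.

(** Powers of v on either side preserve triangles, and a finite check reduces the ten neighbours to
    the four [edge_words] in this way. *)
Lemma adjacent_triangle s : adjacent s -> triangle (K s).
Proof.
move=> adj_s.
have /hasP[t t_edge /hasP[n _ /eqP e]] :
    has (fun t => has (fun n => (nf s).1 == (nf (vword n ++ t)).1) (iota 0 4))
      edge_words.
  apply: (allP (_ : all (fun e => has (fun t => has (fun n =>
    e == (nf (vword n ++ t)).1) (iota 0 4)) edge_words) neighbours)) adj_s.
  by vm_compute.
have [m ->] := nf_eq1 e; apply: triangle_vr.
rewrite kev_cat kev_vword; apply: triangle_vl.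
move: t_edge; rewrite !inE => /or4P[] /eqP->; rewrite ?KV;
  do ?[exact: triangle_uvu|exact: triangle_u|apply: triangle_inv].
Qed.

(** Geometry enters the descent only through the three hypotheses on [ht]. In [ht_local] the coset g
    K is turned so that g b K is one of its lowest neighbours. *)
Variable ht : G -> nat.
Hypothesis htK : forall g s, ht (g * K s) = ht g.
Hypothesis ht_up : forall s, ht 1 < ht (K s * b).
Hypothesis ht_local : forall g, ht 1 < ht g ->
  (forall s, ht (g * b) <= ht (g * K s * b)) ->
  forall s, ht (g * K s * b) <= ht g ->
  [\/ (nf s).1 = (0, 0), adjacent s
     | exists t, [/\ adjacent t, adjacent (kinv t ++ s) & ht (g * K t * b) < ht g]].

(* Reached from K along edges of increasing height. *)
Inductive descending : G -> Prop :=
| descending_K s : descending (K s)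
| descending_step g s t : descending g -> ht g < ht (g * K s * b) ->
    descending (g * K s * b * K t).

Lemma descendingK g s : descending g -> descending (g * K s).
Proof.
case=> [t|h t r dh lt_h]; first by rewrite -kev_cat; apply: descending_K.
by rewrite -mulgA -kev_cat; apply: descending_step.
Qed.

Lemma descending_min g : descending g -> ht 1 <= ht g.
Proof.
elim=> [s|h s t _ le_h lt_h]; first by rewrite -[K s]mul1g htK.
by rewrite htK; apply: leq_trans le_h (ltnW lt_h).
Qed.

(** With x = g s b, the triangle makes g t b K a neighbour of x K. Either the height rises from x,
    or both ends lie below g and the induction hypothesis applies. *)
Let edge g s t : (forall h r, descending h -> ht h < ht g ->
    ht (h * K r * b) < ht g -> descending (h * K r * b)) ->
  triangle (K (kinv s ++ t)) -> ht (g * K s * b) < ht g ->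
  ht (g * K t * b) <= ht g -> descending (g * K s * b) ->
  descending (g * K t * b).
Proof.
move=> IH [p [q h]] lt_s le_t d_s; pose x := g * K s * b.
have e : g * K t * b = x * K p * b * K q.
  rewrite /x; have -> : K t = K s * K (kinv s ++ t) by rewrite kev_cat KV mulVKg.
  by rewrite -!mulgA h !mulgA.
rewrite e; have [lt_xt|] := ltnP (ht x) (ht (x * K p * b)).
  exact: descending_step.
move=> le_xt; apply/descendingK/IH => //.
exact: leq_ltn_trans le_xt lt_s.
Qed.

Lemma descending_b g s : descending g -> descending (g * K s * b).
Proof.
(* The induction is on the larger of the heights at the two ends of the edge. *)
pose m h r := maxn (ht h) (ht (h * K r * b)).
have [n] := ubnP (m g s); elim: n g s => // n IHn g s le_n dg.
have [lt_g|le_g] := ltnP (ht g) (ht (g * K s * b)).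
  by have := descending_step [::] dg lt_g; rewrite kev_nil mulg1.
have IH h r : descending h -> ht h < ht g -> ht (h * K r * b) < ht g ->
    descending (h * K r * b).
  move=> dh lt_h lt_r; apply: IHn => //.
  have le_gn : ht g <= n by move: le_n; rewrite /m (maxn_idPl le_g).
  by apply: leq_trans le_gn; rewrite gtn_max lt_h.
(* Unless g is in K, which [ht_up] excludes, the coset that g was reached from is a lower neighbour;
   [buvub] gives the word leading back to it. *)
have [l [d_l lt_l]] : exists l, descending (g * K l * b) /\
    ht (g * K l * b) < ht g.
  case: dg le_g => [t|h r t dh lt_h _].
    have -> : ht (K t) = ht 1 by rewrite -[K t]mul1g htK.
    by rewrite -kev_cat leqNgt ht_up.
  exists (kinv t ++ uvu).
  have -> : h * K r * b * K t * K (kinv t ++ uvu) * b =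
      h * K (r ++ kinv uvuv).
    by rewrite (kev_cat _ _ (kinv t)) (kev_cat _ _ r) !KV -buvub !mulgA mulgK.
  by rewrite !htK; split=> //; apply: descendingK.
have lt_1 : ht 1 < ht g by apply: leq_ltn_trans lt_l; apply: descending_min.
(* Replacing g by x = g K t, with t of least height, makes x b K a lowest neighbour, as [ht_local]
   demands. *)
have [t t_min] := exists_min (fun t => ht (g * K t * b)) [::].
pose x := g * K t.
have xK r : x * K (kinv t ++ r) = g * K r by rewrite kev_cat KV /x !mulgA mulgK.
have ht_x : ht x = ht g by rewrite htK.
have x_min r : ht (x * b) <= ht (x * K r * b)
  by rewrite /x -(mulgA g (K t) (K r)) -kev_cat; apply: t_min.
rewrite -ht_x in lt_1 IH lt_l le_g.
have x_loc := ht_local lt_1 x_min.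
rewrite -!xK in d_l lt_l le_g *.
clear le_n; move: (kinv t ++ l) (kinv t ++ s) d_l lt_l le_g => {xK}l {}s d_l lt_l le_s.
have adj_inv p q : adjacent (kinv p ++ q) -> triangle (K (kinv q ++ p)).
  move=> /adjacent_triangle/triangle_inv.
  by rewrite !kev_cat !KV invgM invgK.
have v_coset p : (nf p).1 = (0, 0) -> exists a, K p = K (vword a).
  move=> e; have [a ->] := @nf_eq1 p [::] e.
  by exists a; rewrite kev_nil mul1g kev_vword.
have x1 : x * K [::] * b = x * b by rewrite kev_nil mulg1.
have lt_x : ht (x * K [::] * b) < ht x.
  by rewrite x1; apply: leq_ltn_trans lt_l.
(* The chain of lower neighbours first runs from l to the lowest neighbour and afterwards from there
   to s, with links supplied by [edge]. *)
have d_x : descending (x * K [::] * b).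
  have [/v_coset[a e]|adj_l|[r [adj_r adj_rl lt_r]]] := x_loc _ (ltnW lt_l).
  - have -> : x * K [::] * b = x * K l * b * K (kinv (vword a)).
      by rewrite x1 e KV kev_vword -(mulgA x) vXb !mulgA mulgK.
    exact: descendingK.
  - apply: (edge IH _ lt_l) => //; last exact: ltnW.
    by apply: (adj_inv [::]).
  - have le_r := ltnW lt_r.
    apply: (edge IH _ lt_r (ltnW lt_x)); first by apply: (adj_inv [::]).
    by apply: (edge IH _ lt_l le_r) => //; apply: adj_inv.
have [/v_coset[a e]|adj_s|[r [adj_r adj_rs lt_r]]] := x_loc _ le_s.
- have -> : x * K s * b = x * K [::] * b * K (vword a).
    by rewrite x1 e kev_vword -(mulgA x) vXb !mulgA.
  exact: descendingK.
- by apply: (edge IH _ lt_x) => //; apply: adjacent_triangle.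
- apply: (edge IH _ lt_r le_s); first exact: adjacent_triangle.
  by apply: (edge IH _ lt_x (ltnW lt_r)) => //; apply: adjacent_triangle.
Qed.

(** Since u^-1 = u^2, v^-1 = v^3 and b^-1 = b^2, closure under right multiplication by u, v and b
    suffices. *)
Lemma descending_word (X : Type) (gens : X -> G) (w : word X) :
  (forall x, [\/ gens x = u, gens x = v | gens x = b]) ->
  descending (word_eval gens w).
Proof.
move=> gensE.
have d_u g : descending g -> descending (g * u).
  by move/(descendingK [:: true]); rewrite kev_cons kev_nil mulg1.
have d_v g : descending g -> descending (g * v).
  by move/(descendingK [:: false]); rewrite kev_cons kev_nil mulg1.
have d_b g : descending g -> descending (g * b).
  by move/(descending_b [::]); rewrite kev_nil mulg1.
elim/last_ind: w => [|w [x e] IHw].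
  by rewrite /word_eval big_nil -(kev_nil u v); apply: descending_K.
have -> : word_eval gens (rcons w (x, e)) =
    word_eval gens w * (if e then gens x else (gens x)^-1).
  by rewrite /word_eval -cats1 big_cat big_seq1.
case: e; first by case: (gensE x) => ->; auto.
have uV : u^-1 = u * u by apply: mulg1_eq; rewrite -u3 !expgS expg0 mulg1.
have vV : v^-1 = v * v * v.
  by apply: mulg1_eq; rewrite -v4 !expgS expg0 mulg1 !mulgA.
by case: (gensE x) => ->; rewrite ?uV ?vV -?bb !mulgA; auto.
Qed.

(** A last step through b would end strictly above some height that is itself at least [ht 1]. *)
Lemma descending_stab g : descending g -> ht g <= ht 1 -> exists s, g = K s.
Proof.
case=> [s|h s t dh lt_h]; first by exists s.
rewrite htK leqNgt => /negP[].
exact: leq_ltn_trans (descending_min dh) lt_h.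
Qed.

End Descent.

(** * The ring Z[zeta] and Hermitian forms over it *)

Section Integers.
Local Open Scope Z_scope.

(* [Zz a0 a1 a2 a3] is a0 + a1 zeta + a2 zeta^2 + a3 zeta^3. *)
Record zz := Zz { zz0 : Z; zz1 : Z; zz2 : Z; zz3 : Z }.

Definition zz_eqb (a b : zz) : bool :=
  (zz0 a =? zz0 b) && (zz1 a =? zz1 b) && (zz2 a =? zz2 b) && (zz3 a =? zz3 b).

Definition zz_zero := Zz 0 0 0 0.
Definition zz_one := Zz 1 0 0 0.

Definition zz_add (a b : zz) : zz :=
  Zz (zz0 a + zz0 b) (zz1 a + zz1 b) (zz2 a + zz2 b) (zz3 a + zz3 b).

Definition zz_opp (a : zz) : zz := Zz (- zz0 a) (- zz1 a) (- zz2 a) (- zz3 a).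

Definition zz_scale (k : Z) (a : zz) : zz :=
  Zz (k * zz0 a) (k * zz1 a) (k * zz2 a) (k * zz3 a).

(** [c4], [c5] and [c6] are the coefficients of zeta^4 = zeta^2 - 1, zeta^5 = zeta^3 - zeta and
    zeta^6 = -1. *)
Definition zz_mul (a b : zz) : zz :=
  let: Zz a0 a1 a2 a3 := a in
  let: Zz b0 b1 b2 b3 := b in
  let c4 := a1 * b3 + a2 * b2 + a3 * b1 in
  let c5 := a2 * b3 + a3 * b2 in
  let c6 := a3 * b3 in
  Zz (a0 * b0 - c4 - c6) (a0 * b1 + a1 * b0 - c5)
     (a0 * b2 + a1 * b1 + a2 * b0 + c4)
     (a0 * b3 + a1 * b2 + a2 * b1 + a3 * b0 + c5).

Definition zz_conj (a : zz) : zz :=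
  Zz (zz0 a + zz2 a) (zz1 a) (- zz2 a) (- zz1 a - zz3 a).

(* The Galois conjugation zeta |-> - zeta, which maps sqrt 3 to - sqrt 3. *)
Definition zz_gal (a : zz) : zz := Zz (zz0 a) (- zz1 a) (zz2 a) (- zz3 a).

(* [(p, q)] is p + q sqrt 3. *)
Definition rz := (Z * Z)%type.

Definition rz_add (x y : rz) : rz := (x.1 + y.1, x.2 + y.2).
Definition rz_opp (x : rz) : rz := (- x.1, - x.2).
Definition rz_scale (k : Z) (x : rz) : rz := (k * x.1, k * x.2).
Definition rz_mul (x y : rz) : rz :=
  (x.1 * y.1 + 3 * (x.2 * y.2), x.1 * y.2 + x.2 * y.1).
(** This uses sqrt 3 = zeta + zeta^-1 = 2 zeta - zeta^3. *)
Definition rz_zz (x : rz) : zz := Zz x.1 (2 * x.2) 0 (- x.2).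

(** The squared absolute value. Its rational part is a sum of two Eisenstein forms, hence positive
    definite. *)
Definition zz_norm (a : zz) : rz :=
  let: Zz a0 a1 a2 a3 := a in
  (a0 * a0 + a0 * a2 + a2 * a2 + a1 * a1 + a1 * a3 + a3 * a3,
   a0 * a1 + a1 * a2 + a2 * a3).

(* 71 / 41 < sqrt 3 < 97 / 56 *)
Definition rz_pos (x : rz) : bool :=
  if 0 <=? x.2 then 0 <? 41 * x.1 + 71 * x.2
  else 0 <? 56 * x.1 + 97 * x.2.

(* Upper triangle of a Hermitian matrix; the form is x |-> x H x^*. *)
Record herm := Herm { h11 : rz; h22 : rz; h33 : rz; h12 : zz; h13 : zz; h23 : zz }.

Definition herm_add (H : herm) (k : Z) (H' : herm) : herm :=
  Herm (rz_add (h11 H) (rz_scale k (h11 H'))) (rz_add (h22 H) (rz_scale k (h22 H')))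
    (rz_add (h33 H) (rz_scale k (h33 H'))) (zz_add (h12 H) (zz_scale k (h12 H')))
    (zz_add (h13 H) (zz_scale k (h13 H'))) (zz_add (h23 H) (zz_scale k (h23 H'))).

Definition herm0 : herm := Herm (0, 0) (0, 0) (0, 0) zz_zero zz_zero zz_zero.

Definition vec := (zz * zz * zz)%type.

Definition outer (s : vec) : herm :=
  let: (s1, s2, s3) := s in
  Herm (zz_norm s1) (zz_norm s2) (zz_norm s3) (zz_mul s1 (zz_conj s2))
    (zz_mul s1 (zz_conj s3)) (zz_mul s2 (zz_conj s3)).

Definition herm_last : herm := Herm (0, 0) (0, 0) (1, 0) zz_zero zz_zero zz_zero.

(** This is F^-1, which takes the value 1 on the last row of a unitary matrix. *)
Definition herm_dual : herm :=
  Herm (1, -1) (-1, -1) (1, 0) (zz_opp zz_one) zz_zero zz_zero.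

(* Completing the square: h11 H equals a square plus the binary form with
   coefficients e22, e23, e33. *)
Definition herm_posdef (H : herm) : bool :=
  let d := h11 H in
  let e22 := rz_add (rz_mul d (h22 H)) (rz_opp (zz_norm (h12 H))) in
  let e33 := rz_add (rz_mul d (h33 H)) (rz_opp (zz_norm (h13 H))) in
  let e23 := zz_add (zz_mul (rz_zz d) (h23 H))
    (zz_opp (zz_mul (zz_conj (h12 H)) (h13 H))) in
  [&& rz_pos d, rz_pos e22 &
      rz_pos (rz_add (rz_mul e22 e33) (rz_opp (zz_norm e23)))].

End Integers.

(** * The embedding of Z[zeta] into the complex numbers *)

Section Embedding.
#[local] Arguments Z.mul : simpl never.
#[local] Arguments Z.add : simpl never.
#[local] Arguments Z.sub : simpl never.
#[local] Arguments Z.opp : simpl never.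
Local Open Scope ring_scope.
Local Open Scope complex_scope.
Variable R : realType.
Local Notation C := R[i].
Local Notation zeta := (zeta R).

Definition zr (n : Z) : R := (int_of_Z n)%:~R.

Lemma zrD m n : zr (Z.add m n) = zr m + zr n.
Proof.
have h : int_of_Z (Z.add m n) = int_of_Z m + int_of_Z n by exact: rmorphD.
by rewrite /zr h intrD.
Qed.
Lemma zrM m n : zr (Z.mul m n) = zr m * zr n.
Proof.
have h : int_of_Z (Z.mul m n) = int_of_Z m * int_of_Z n by exact: rmorphM.
by rewrite /zr h intrM.
Qed.
Lemma zrN n : zr (Z.opp n) = - zr n.
Proof.
have h : int_of_Z (Z.opp n) = - int_of_Z n by exact: rmorphN.
by rewrite /zr h mulrNz.
Qed.
Lemma zrB m n : zr (Z.sub m n) = zr m - zr n.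
Proof. by rewrite /Z.sub zrD zrN. Qed.
Definition zrE := (zrB, zrD, zrM, zrN).

Lemma zr_gt0 n : Z.ltb 0 n -> 0 < zr n.
Proof. by case: n => // p _; rewrite /zr ltr0z; have [k /= ->] := Pos2Nat.is_succ p. Qed.

Lemma zr0 : zr 0 = 0. Proof. by []. Qed.
Lemma zr1 : zr 1 = 1. Proof. by []. Qed.
Lemma zr2 : zr 2 = 2. Proof. by []. Qed.
Lemma zr3 : zr 3 = 3. Proof. by []. Qed.

Definition r3 : R := Num.sqrt 3.
Lemma r3_sqr : r3 * r3 = 3. Proof. by rewrite -expr2 sqr_sqrtr. Qed.
Lemma r3_gt0 : 0 < r3. Proof. by rewrite sqrtr_gt0. Qed.

Lemma r3_lb : 71 < 41 * r3.
Proof. have := r3_sqr; have := r3_gt0; nra. Qed.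

Lemma r3_ub : 56 * r3 < 97.
Proof. have := r3_sqr; have := r3_gt0; nra. Qed.

(** The equation [zeta4], the relation c^2 + s^2 = 1 and the positivity of cosine and sine determine
    both coordinates. *)
Lemma zeta_val : zeta = (r3 / 2) +i* (1 / 2).
Proof.
have c0 : 0 < cos (2 * pi / 12 : R).
  by apply: cos_gt0_pihalf; have := pi_gt0 R; lra.
have s0 : 0 < sin (2 * pi / 12 : R).
  by apply: sin_gt0_pi; have := pi_gt0 R; lra.
have h1 := cos2Dsin2 (2 * pi / 12 : R).
have /eqP := zeta4 R; rewrite eq_complex /zeta.
move: (cos _) (sin _) c0 s0 h1 => c s c0 s0 h1.
rewrite !exprS !expr0 /= => /andP[/eqP h2 /eqP h3].
have r2 := r3_sqr; have r0 := r3_gt0.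
have /eqP : c * s * (2 * (c ^+ 2 - s ^+ 2) - 1) = 0.
  have -> : c * s * (2 * (c ^+ 2 - s ^+ 2) - 1) =
    (c * s) * (2 * (c ^+ 2 - s ^+ 2) * (c ^+ 2 + s ^+ 2) - 1) by rewrite h1 mulr1.
  by move: h3; rewrite h1; lra.
rewrite !mulf_eq0 (gt_eqF c0) (gt_eqF s0) /= => /eqP h4.
have /eqP hs : (s - 1 / 2) * (s + 1 / 2) = 0 by lra.
have {}hs : s = 1 / 2.
  by move: hs; rewrite mulf_eq0 => /orP[/eqP|/eqP]; lra.
have /eqP hc : (c - r3 / 2) * (c + r3 / 2) = 0 by rewrite hs in h1; lra.
have {}hc : c = r3 / 2.
  by move: hc; rewrite mulf_eq0 => /orP[/eqP|/eqP]; lra.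
by rewrite hs hc.
Qed.

Definition zval (a : zz) : C :=
  (zr (zz0 a) + zr (zz1 a) * (r3 / 2) + zr (zz2 a) * (1 / 2)) +i*
  (zr (zz1 a) * (1 / 2) + zr (zz2 a) * (r3 / 2) + zr (zz3 a)).

Definition rval (x : rz) : R := zr x.1 + zr x.2 * r3.

Definition sqn (z : C) : R := complex.Re z ^+ 2 + complex.Im z ^+ 2.

Lemma complexP (z w : C) :
  complex.Re z = complex.Re w -> complex.Im z = complex.Im w -> z = w.
Proof. by case: z w => [a b] [c d] /= -> ->. Qed.

Lemma zval_add a b : zval (zz_add a b) = zval a + zval b.
Proof. by apply: complexP; rewrite /= !zrE; ring. Qed.

Lemma zval_opp a : zval (zz_opp a) = - zval a.
Proof. by apply: complexP; rewrite /= !zrE; ring. Qed.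

Lemma zval_scale k a : zval (zz_scale k a) = (zr k)%:C * zval a.
Proof. by apply: complexP; rewrite /= !zrE; ring. Qed.

Lemma zval_mul a b : zval (zz_mul a b) = zval a * zval b.
Proof.
have r2 := r3_sqr; case: a b => [a0 a1 a2 a3] [b0 b1 b2 b3].
by apply: complexP; rewrite /= !zrE; field: r2.
Qed.

Lemma zval_conj a : zval (zz_conj a) = (zval a)^*.
Proof. by apply: complexP; rewrite /= !zrE; field. Qed.

Lemma zval0 : zval zz_zero = 0.
Proof. by apply: complexP; rewrite /= ?zr0 ?zr1; ring. Qed.

Lemma zval1 : zval zz_one = 1.
Proof. by apply: complexP; rewrite /= ?zr0 ?zr1; ring. Qed.

Lemma zval_zeta : zval (Zz 0 1 0 0) = zeta.
Proof. by rewrite zeta_val; apply: complexP; rewrite /= ?zr0 ?zr1; ring. Qed.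

Lemma rval_add x y : rval (rz_add x y) = rval x + rval y.
Proof. by rewrite /rval /= !zrE; ring. Qed.

Lemma rval_opp x : rval (rz_opp x) = - rval x.
Proof. by rewrite /rval /= !zrE; ring. Qed.

Lemma rval_scale k x : rval (rz_scale k x) = zr k * rval x.
Proof. by rewrite /rval /= !zrE; ring. Qed.

Lemma rval_mul x y : rval (rz_mul x y) = rval x * rval y.
Proof.
have r2 := r3_sqr; case: x y => [p q] [p' q'].
by rewrite /rval /= !zrE zr3; ring: r2.
Qed.

Lemma zval_rz x : zval (rz_zz x) = (rval x)%:C.
Proof.
by apply: complexP; rewrite /= /rval !zrE ?zr0 ?zr2; field.
Qed.

Lemma rz_posP x : rz_pos x -> 0 < rval x.
Proof.
have lb := r3_lb; have ub := r3_ub; rewrite /rz_pos /rval; case: x => p q /=.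
case E: (Z.leb 0 q) => /zr_gt0; rewrite zrD !zrM.
  have q0 : 0 <= zr q by case: q E => // k _; apply/ltW/zr_gt0.
  rewrite (_ : zr 41 = 41) // (_ : zr 71 = 71) //; nra.
have q0 : 0 < - zr q by case: q E => // k _; rewrite -zrN zr_gt0.
rewrite (_ : zr 56 = 56) // (_ : zr 97 = 97) //; nra.
Qed.

Lemma sqn_ge0 z : 0 <= sqn z.
Proof. by rewrite addr_ge0 ?sqr_ge0. Qed.

Lemma sqnM z w : sqn (z * w) = sqn z * sqn w.
Proof. by case: z w => [a b] [c d]; rewrite /sqn /=; ring. Qed.

Lemma sqn_zval a : sqn (zval a) = rval (zz_norm a).
Proof.
have r2 := r3_sqr; case: a => [a0 a1 a2 a3].
by rewrite /sqn /rval /= !zrE; field: r2.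
Qed.

End Embedding.

(** * Neighbours excluded by definite forms *)

Definition zz_zeta_exp (n : nat) : zz := iter n (zz_mul (Zz 0 1 0 0)) zz_one.

(** Entry j holds the first two coordinates of the third column of d_j b. The central element (uv)^2
    multiplies both by zeta, hence the factor [w] in [neighbour]. *)
Definition neighbour_base : seq (zz * zz) :=
  [:: (zz_zero, Zz 0 0 (-1) (-1)); (Zz (-1) 0 0 0, Zz 0 (-1) (-1) 0);
      (Zz 0 0 (-1) 0, Zz 0 (-1) (-1) (-1)); (Zz 0 1 0 (-1), Zz 1 0 (-1) (-1));
      (Zz 0 0 1 0, zz_zero); (Zz (-1) (-1) 1 0, Zz (-1) (-1) 0 1)].

(* The third column of c b, where c is the coset representative of index [e]. *)
Definition neighbour (e : nat * nat) : vec :=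
  let: (p, q) := nth (zz_zero, zz_zero) neighbour_base e.1 in
  let w := zz_zeta_exp e.2 in
  (zz_mul w p, zz_mul w q, Zz 1 1 0 (-1)).

Definition far_neighbours : seq (nat * nat) :=
  [:: (1, 1); (1, 10); (2, 2); (2, 11); (3, 2); (3, 11); (4, 2); (4, 11)].

Section Certificates.

(* [(i, (b, e, ms))] asserts that the Hermitian form
     e |<x, s_i>|^2 - e |x_3|^2 - b N(x)
       - sum_((j, m) in ms) m (|<x, s_j>|^2 - |<x, s_0>|^2)
   is positive definite, where N is the dual form and s_j the j-th neighbour. *)
Definition certificates : seq ((nat * nat) * (nat * nat * seq ((nat * nat) * nat))) :=
  [::
    ((0, 2), (1, 2, [:: ((0, 1), 2)])); ((0, 3), (1, 1, [:: ((0, 2), 1)]));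
    ((0, 4), (1, 1, [:: ((0, 3), 1)])); ((0, 5), (2, 2, [:: ((0, 5), 1)]));
    ((0, 6), (2, 2, [:: ((0, 6), 1)])); ((0, 7), (1, 1, [:: ((0, 8), 1)]));
    ((0, 8), (1, 1, [:: ((0, 10), 1)])); ((0, 9), (1, 1, [:: ((0, 10), 1)]));
    ((0, 10), (1, 2, [:: ((0, 11), 2)])); ((1, 2), (4, 3, [:: ((2, 1), 3)]));
    ((1, 3), (2, 2, [:: ((2, 2), 1)])); ((1, 4), (2, 1, [:: ((2, 2), 1)]));
    ((1, 5), (2, 2, [:: ((5, 6), 1)])); ((1, 6), (2, 2, [:: ((5, 6), 1)]));
    ((1, 7), (2, 2, [:: ((5, 7), 1)])); ((1, 8), (2, 2, [:: ((4, 11), 1)]));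
    ((1, 9), (4, 3, [:: ((4, 0), 3)])); ((2, 3), (4, 3, [:: ((3, 1), 3)]));
    ((2, 4), (2, 2, [:: ((3, 2), 1)])); ((2, 5), (2, 1, [:: ((3, 2), 1)]));
    ((2, 6), (2, 2, [:: ((5, 9), 1)])); ((2, 7), (2, 2, [:: ((5, 9), 1)]));
    ((2, 8), (2, 1, [:: ((1, 10), 1)]));
    ((2, 9), (3, 3, [:: ((1, 11), 1); ((4, 1), 1)]));
    ((2, 10), (4, 3, [:: ((1, 11), 3)])); ((3, 3), (4, 3, [:: ((4, 1), 3)]));
    ((3, 4), (2, 2, [:: ((4, 2), 1)])); ((3, 5), (2, 1, [:: ((4, 2), 1)]));
    ((3, 6), (2, 2, [:: ((5, 0), 1)])); ((3, 7), (2, 2, [:: ((5, 0), 1)]));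
    ((3, 8), (2, 1, [:: ((2, 11), 1)])); ((3, 9), (2, 2, [:: ((2, 11), 1)]));
    ((3, 10), (4, 3, [:: ((2, 0), 3)])); ((4, 3), (4, 3, [:: ((1, 0), 3)]));
    ((4, 4), (2, 2, [:: ((1, 1), 1)])); ((4, 5), (2, 1, [:: ((1, 1), 1)]));
    ((4, 6), (2, 2, [:: ((5, 3), 1)])); ((4, 7), (2, 2, [:: ((5, 3), 1)]));
    ((4, 8), (2, 1, [:: ((3, 11), 1)])); ((4, 9), (2, 2, [:: ((3, 11), 1)]));
    ((4, 10), (4, 3, [:: ((3, 0), 3)]));
    ((5, 0), (7, 4, [:: ((1, 0), 4); ((1, 11), 4)]));
    ((5, 1), (3, 2, [:: ((1, 0), 3)])); ((5, 2), (3, 2, [:: ((2, 0), 3)]));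
    ((5, 3), (7, 4, [:: ((2, 0), 4); ((2, 1), 4)]));
    ((5, 4), (3, 2, [:: ((2, 1), 3)])); ((5, 5), (3, 2, [:: ((3, 0), 3)]));
    ((5, 6), (7, 4, [:: ((3, 0), 4); ((3, 1), 4)]));
    ((5, 7), (3, 2, [:: ((3, 1), 3)])); ((5, 8), (3, 2, [:: ((4, 0), 3)]));
    ((5, 9), (7, 4, [:: ((4, 0), 4); ((4, 1), 4)]));
    ((5, 10), (3, 2, [:: ((4, 1), 3)])); ((5, 11), (3, 2, [:: ((1, 11), 3)]))].

Definition certificate_form (i : nat * nat) (b e : nat)
    (ms : seq ((nat * nat) * nat)) : herm :=
  foldr (fun jm H =>
      herm_add (herm_add H (Z.opp (Z.of_nat jm.2)) (outer (neighbour jm.1)))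
        (Z.of_nat jm.2) (outer (neighbour (0, 0))))
    (herm_add (herm_add (herm_add herm0 (Z.opp (Z.of_nat b)) herm_dual)
       (Z.opp (Z.of_nat e)) herm_last) (Z.of_nat e) (outer (neighbour i))) ms.

Definition certificate_ok (c : (nat * nat) * (nat * nat * seq ((nat * nat) * nat))) :=
  let: (i, (b, e, ms)) := c in
  [&& 0 < b, all (fun jm => jm.1.1 < 6) ms
    & herm_posdef (certificate_form i b e ms)].

Lemma certificates_ok : all certificate_ok certificates.
Proof. by vm_compute. Qed.

(** The 72 indices split as 1 + 10 + 8 + 53. *)
Lemma index_cases : all (fun e => [|| e == (0, 0), e \in neighbours,
    e \in far_neighbours | e \in [seq c.1 | c <- certificates]])
  [seq (j, n) | j <- iota 0 6, n <- iota 0 12].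
Proof. by vm_compute. Qed.

End Certificates.

(** * Values of the Hermitian forms on complex rows *)

Section Forms.
Local Open Scope ring_scope.
Local Open Scope complex_scope.
Variable R : realType.
Local Notation C := R[i].
Implicit Types x : C * C * C.

Definition dot x (s : vec) : C :=
  x.1.1 * zval R s.1.1 + x.1.2 * zval R s.1.2 + x.2 * zval R s.2.

Definition cross (x y h : C) : R := 2 * complex.Re (x * h * y^*).

Definition hev (H : herm) x : R :=
  rval R (h11 H) * sqn x.1.1 + rval R (h22 H) * sqn x.1.2 +
  rval R (h33 H) * sqn x.2 + cross x.1.1 x.1.2 (zval R (h12 H)) +
  cross x.1.1 x.2 (zval R (h13 H)) + cross x.1.2 x.2 (zval R (h23 H)).

Definition dual_norm x : R :=
  sqn x.2 - ((r3 R - 1) * sqn x.1.1 + cross x.1.1 x.1.2 1 + (r3 R + 1) * sqn x.1.2).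

Lemma hev_add H k H' x : hev (herm_add H k H') x = hev H x + zr R k * hev H' x.
Proof.
rewrite /hev /= !rval_add !rval_scale !zval_add !zval_scale /cross.
case: x => [[[x1 y1] [x2 y2]] [x3 y3]].
move: (zval _ (h12 H)) (zval _ (h13 H)) (zval _ (h23 H)) => [? ?] [? ?] [? ?].
move: (zval _ (h12 H')) (zval _ (h13 H')) (zval _ (h23 H')) => [? ?] [? ?] [? ?].
by rewrite /=; ring.
Qed.

Lemma hev0 x : hev herm0 x = 0.
Proof.
rewrite /hev /= /cross zval0 /rval /= zr0.
by case: x => [[[x1 y1] [x2 y2]] [x3 y3]] /=; ring.
Qed.

Lemma hev_last x : hev herm_last x = sqn x.2.
Proof.
rewrite /hev /= /cross zval0 /rval /= zr0 zr1.
by case: x => [[[x1 y1] [x2 y2]] [x3 y3]] /=; ring.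
Qed.

Lemma hev_dual x : hev herm_dual x = dual_norm x.
Proof.
rewrite /hev /dual_norm [h12 _]/= zval_opp zval1 /= /cross zval0 /rval /= zr0 zr1.
rewrite (_ : zr R (-1) = -1) //.
by case: x => [[[x1 y1] [x2 y2]] [x3 y3]] /=; ring.
Qed.

Lemma hev_outer s x : hev (outer s) x = sqn (dot x s).
Proof.
case: s => [[s1 s2] s3].
rewrite /hev /dot /= -!sqn_zval !zval_mul !zval_conj /cross /sqn.
case: x => [[[x1 y1] [x2 y2]] [x3 y3]].
move: (zval _ s1) (zval _ s2) (zval _ s3) => [? ?] [? ?] [? ?].
by rewrite /=; ring.
Qed.

Lemma binary_form_ge0 (d e : R) (h x y : C) : 0 < d -> 0 < d * e - sqn h ->
  0 <= d * sqn x + e * sqn y + cross x y h.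
Proof.
move=> d0 det0; rewrite -(pmulr_rge0 _ d0).
have -> : d * (d * sqn x + e * sqn y + cross x y h) =
    sqn (d%:C * x + h^* * y) + (d * e - sqn h) * sqn y.
  by rewrite /sqn /cross; case: h x y {det0} => [? ?] [? ?] [? ?] /=; ring.
by rewrite addr_ge0 ?mulr_ge0 ?sqn_ge0 // ltW.
Qed.

Lemma hev_posdef H x : herm_posdef H -> 0 <= hev H x.
Proof.
rewrite /herm_posdef => /and3P[/rz_posP-/(_ R) d0 /rz_posP-/(_ R) e0 /rz_posP-/(_ R)].
rewrite !(rval_add, rval_mul, rval_opp) -!sqn_zval in d0 e0 *.
rewrite !(zval_add, zval_mul, zval_opp, zval_conj) zval_rz.
rewrite /hev; move: d0 e0.
move: (rval _ (h11 H)) (rval _ (h22 H)) (rval _ (h33 H)) => d1 d2 d3.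
move: (zval _ (h12 H)) (zval _ (h13 H)) (zval _ (h23 H)) => a12 a13 a23 d0 e0 det0.
case: x => [[x1 x2] x3] /=; rewrite -(pmulr_rge0 _ d0).
have := binary_form_ge0 x2 x3 e0 det0.
set q := (X in 0 <= X) => q_ge0.
suff -> : d1 * (d1 * sqn x1 + d2 * sqn x2 + d3 * sqn x3 + cross x1 x2 a12 +
    cross x1 x3 a13 + cross x2 x3 a23) =
    sqn (d1%:C * x1 + a12^* * x2 + a13^* * x3) + q by rewrite addr_ge0 ?sqn_ge0.
rewrite /q /cross /sqn {d0 e0 det0 q q_ge0}.
case: x1 x2 x3 a12 a13 a23 => [? ?] [? ?] [? ?] [? ?] [? ?] [? ?] /=; ring.
Qed.

Lemma zr_nat n : zr R (Z.of_nat n) = n%:R.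
Proof. by rewrite /zr (Z_of_intK (Posz n)). Qed.

Lemma certificate_sound c x : certificate_ok c -> 0 < dual_norm x ->
  (forall e, (e.1 < 6)%N ->
    sqn (dot x (neighbour (0, 0)%N)) <= sqn (dot x (neighbour e))) ->
  sqn x.2 < sqn (dot x (neighbour c.1)).
Proof.
case: c => i [[b e] ms] /and3P[b0 ms6 /(@hev_posdef _ x) form_ge0] x0 f_min.
rewrite ltNge; apply/negP => /= f_i.
have : hev (certificate_form i b e ms) x <=
    e%:R * (sqn (dot x (neighbour i)) - sqn x.2) - b%:R * dual_norm x.
  rewrite /certificate_form; move: (neighbour (0, 0)%N) f_min => s0 f_min.
  elim: ms ms6 {form_ge0} => [_|[j m] ms IHms] /=.
    rewrite !hev_add hev0 hev_last hev_dual hev_outer !zrN !zr_nat; lra.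
  case/andP=> j6 /IHms; apply: le_trans.
  rewrite !hev_add !hev_outer zrN zr_nat.
  have := ler_wpM2l (ler0n R m) (f_min _ j6). lra.
have : 0 < b%:R * dual_norm x by rewrite mulr_gt0 ?ltr0n.
have : e%:R * (sqn (dot x (neighbour i)) - sqn x.2) <= 0.
  by rewrite mulr_ge0_le0 ?ler0n // subr_le0.
move: form_ge0; lra.
Qed.

End Forms.

(** * Far neighbours *)

Section FarCore.
Local Open Scope ring_scope.
Local Open Scope complex_scope.

(** With P = X + iY and Q = U - iV, this is [far_core] in coordinates. S and E are the real and
    imaginary parts of P + Q, D and T those of P - Q; the parallelogram law bounds the sum of their
    squares by 4. *)
Lemma far_core_real (R : realType) (r X Y U V : R) :
  r * r = 3 -> 0 < r ->
  X ^+ 2 + Y ^+ 2 <= 1 -> U ^+ 2 + V ^+ 2 <= 1 ->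
  r * X - Y <= X ^+ 2 + Y ^+ 2 -> r * U - V <= U ^+ 2 + V ^+ 2 ->
  r * (X + U) + (Y - V) <= (X + U) ^+ 2 + (Y - V) ^+ 2 ->
  r * (X + U) - (Y - V) <= (X + U) ^+ 2 + (Y - V) ^+ 2 ->
  0 <= 4 * (X + U) - 2 * r - (r - 1) * ((X + U) ^+ 2 + (Y - V) ^+ 2)
     - (r - 1) / 2 * ((Y + V - X - U) ^+ 2 + (X - U + Y - V) ^+ 2) <= 1 ->
  False.
Proof.
move=> r2 r0 h1 h2 h3 h4 h5 h6 /andP[n0 n1].
have r_lb : 71 < 41 * r by nra.
have r_ub : 56 * r < 97 by nra.
pose S := X + U; pose E := Y - V; pose T := Y + V; pose D := X - U.
have hSE : S ^+ 2 + D ^+ 2 + T ^+ 2 + E ^+ 2 <= 4 by rewrite /S /E /T /D; lra.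
have hT : r * S - 2 <= T by rewrite /S /T; lra.
rewrite -/S -/E in h5 h6 n0 n1.
rewrite (_ : Y + V - X - U = T - S) in n0 n1; last by rewrite /T /S; lra.
rewrite (_ : X - U + Y - V = D + E) in n0 n1; last by rewrite /D /E; lra.
move: S E T D hSE hT h5 h6 n0 n1 => S E T D hSE hT h5 h6 n0 n1 {h1 h2 h3 h4}.
have hS : (r - 1) * (S ^+ 2 + E ^+ 2) <= 4 * S - 2 * r.
  have : 0 <= (r - 1) / 2 * ((T - S) ^+ 2 + (D + E) ^+ 2).
    by rewrite mulr_ge0 ?addr_ge0 ?sqr_ge0 //; lra.
  lra.
have hrS : r * S <= S ^+ 2 + E ^+ 2 by lra.
(* [hS] and [hrS] together give S >= 3 - sqrt 3. *)
have S_gt : 6 / 5 < S by nra.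
(* For S < sqrt 3, [h5] and [h6] force |E| > 1, whence S >= 5 - 2 sqrt 3, and S^2 + E^2 + T^2
   exceeds 4. *)
have [S_lt|S_ge] := ltP S r.
  have E1 : r * S + 1 <= S ^+ 2 + E ^+ 2.
    have : 0 < S * (r - S) by rewrite mulr_gt0 //; lra.
    have [E0|E0] := leP 0 E; nra.
  have S1 : 5 - 2 * r <= S.
    have : (r - 1) * (r * S + 1) <= 4 * S - 2 * r.
      by apply: le_trans hS; rewrite ler_wpM2l //; lra.
    nra.
  have g1 : 5 * r - 6 <= r * S by nra.
  have T0 : 0 <= r * S - 2 by lra.
  have T2 : (r * S - 2) ^+ 2 <= T ^+ 2 by rewrite !expr2 ler_pM //; lra.
  have D0 := sqr_ge0 D.
  nra.
(* For S >= sqrt 3, S^2 >= 3 and T^2 >= 1 exhaust the bound 4. The only point left is S = sqrt 3, T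
   = 1, D = E = 0, where the form is 8 - 4 sqrt 3 > 1. *)
have g1 : 3 <= r * S by nra.
have T1 : 1 <= T by lra.
have T2 : 1 <= T ^+ 2 by rewrite expr2 -[1]mulr1 ler_pM.
have S2 : 3 <= S ^+ 2 by nra.
have D0 := sqr_ge0 D; have E0 := sqr_ge0 E.
have /eqP : D ^+ 2 = 0 by lra.
rewrite sqrf_eq0 => /eqP D1.
have /eqP : E ^+ 2 = 0 by lra.
rewrite sqrf_eq0 => /eqP E1.
have S3 : S = r by nra.
have T3 : T = 1 by nra.
by move: n1; rewrite D1 E1 S3 T3; nra.
Qed.

End FarCore.

Definition rz_eqb (x y : rz) : bool := Z.eqb x.1 y.1 && Z.eqb x.2 y.2.

Definition herm_eqb (H H' : herm) : bool :=
  [&& rz_eqb (h11 H) (h11 H'), rz_eqb (h22 H) (h22 H'), rz_eqb (h33 H) (h33 H'),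
      zz_eqb (h12 H) (h12 H') & zz_eqb (h13 H) (h13 H') && zz_eqb (h23 H) (h23 H')].

Lemma zz_eqbP a b : zz_eqb a b -> a = b.
Proof.
case: a b => [a0 a1 a2 a3] [b0 b1 b2 b3]; rewrite /zz_eqb /= -!andbA.
by case/and4P=> /Z.eqb_spec-> /Z.eqb_spec-> /Z.eqb_spec-> /Z.eqb_spec->.
Qed.

Lemma rz_eqbP x y : rz_eqb x y -> x = y.
Proof.
by case: x y => [p q] [p' q'] /andP[/= /Z.eqb_spec-> /Z.eqb_spec->].
Qed.

Lemma herm_eqbP H H' : herm_eqb H H' -> H = H'.
Proof.
case: H H' => [????? ?] [????? ?] /and5P[/= /rz_eqbP-> /rz_eqbP-> /rz_eqbP->].
by move=> /zz_eqbP-> /andP[/zz_eqbP-> /zz_eqbP->].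
Qed.

Definition vec_scale (w : zz) (s : vec) : vec :=
  (zz_mul w s.1.1, zz_mul w s.1.2, zz_mul w s.2).
Definition vec_add (s t : vec) : vec :=
  (zz_add s.1.1 t.1.1, zz_add s.1.2 t.1.2, zz_add s.2 t.2).
Definition vec_last : vec := (zz_zero, zz_zero, zz_one).

Definition herm_scale (k : rz) (H : herm) : herm :=
  Herm (rz_mul k (h11 H)) (rz_mul k (h22 H)) (rz_mul k (h33 H))
    (zz_mul (rz_zz k) (h12 H)) (zz_mul (rz_zz k) (h13 H)) (zz_mul (rz_zz k) (h23 H)).

Section FarForm.
Local Open Scope Z_scope.
(** The Hermitian matrix of [far_form] composed with the linear forms t, A and B. *)
Definition far_herm (t A B : vec) : herm :=
  let W := vec_add A B in
  herm_add
    (herm_add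
      (herm_add
        (herm_scale (-2, -2) (outer t)) 1 (herm_scale (-1, -1) (outer W)))
      1 (herm_scale (1, -1) (outer (vec_add (vec_scale (zz_zeta_exp 3) A) B))))
    2 (outer (vec_add W t)).
End FarForm.

(* [(i, (s, t), cs)]: i is a far neighbour, {s, t} = {(0, 0), i} in the order
   that makes the identities of [far_ok] hold, and cs lists the common
   neighbours of (0, 0) and i. *)
Definition far_data :
    seq ((nat * nat) * ((nat * nat) * (nat * nat)) * seq (nat * nat)) :=
  [:: ((1, 1), ((1, 1), (0, 0)), [:: (1, 0); (0, 1); (2, 1); (2, 0)]);
      ((1, 10), ((0, 0), (1, 10)), [:: (0, 11); (1, 11); (4, 1); (4, 0)]);
      ((2, 2), ((2, 2), (0, 0)), [:: (2, 1); (0, 1); (3, 1); (3, 0)]);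
      ((2, 11), ((0, 0), (2, 11)), [:: (0, 11); (2, 0); (1, 0); (1, 11)]);
      ((3, 2), ((3, 2), (0, 0)), [:: (3, 1); (0, 1); (4, 1); (4, 0)]);
      ((3, 11), ((0, 0), (3, 11)), [:: (0, 11); (3, 0); (2, 1); (2, 0)]);
      ((4, 2), ((4, 2), (0, 0)), [:: (4, 1); (0, 1); (1, 0); (1, 11)]);
      ((4, 11), ((0, 0), (4, 11)), [:: (0, 11); (4, 0); (3, 1); (3, 0)])].

Definition far_A (s : nat * nat) : vec := vec_scale (zz_zeta_exp 2) (neighbour s).
Definition far_B (t : nat * nat) : vec := vec_scale (zz_zeta_exp 11) (neighbour t).

(** With e = [vec_last], the common neighbours are, up to powers of zeta, the four vectors A -
    zeta^11 e, B - zeta e, A + B - zeta e and A + B - zeta^11 e of [far_homogeneous]; the last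
    identity rewrites twice the dual form. *)
Definition far_ok (d : (nat * nat) * ((nat * nat) * (nat * nat)) * seq (nat * nat))
    : Prop :=
  let: (i, (s, t), cs) := d in
  let A := far_A s in let B := far_B t in let W := vec_add A B in
  let c k := neighbour (nth (0, 0) cs k) in
  let minus n := vec_scale (zz_opp (zz_zeta_exp n)) vec_last in
  [/\ (s = i /\ t = (0, 0)) \/ (s = (0, 0) /\ t = i), size cs = 4,
      c 0 = vec_scale (zz_zeta_exp 9) (vec_add A (minus 11)),
      c 1 = vec_scale (zz_zeta_exp 2) (vec_add B (minus 1)) &
  [/\ c 2 = vec_scale (zz_zeta_exp 0) (vec_add W (minus 1)),
      c 3 = vec_scale (zz_zeta_exp 11) (vec_add W (minus 11)) &
      herm_add herm_dual 1 herm_dual = far_herm vec_last A B]].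

Lemma far_data_ok d : d \in far_data -> far_ok d.
Proof.
rewrite !inE; do ![case/orP]; move/eqP=> ->.
all: split; [by [left; split|right; split]|by []|..].
all: by vm_compute.
Qed.

Section FarNeighbours.
Local Open Scope ring_scope.
Local Open Scope complex_scope.
Variable R : realType.
Local Notation C := R[i].
Implicit Types x : C * C * C.

Definition far_form (t A B : C) : R :=
  2 * sqn (A + B + t) - (r3 R + 1) * (2 * sqn t + sqn (A + B)) -
  (r3 R - 1) * sqn (zeta R ^+ 3 * A + B).

Lemma far_core (P Q : C) : sqn P <= 1 -> sqn Q <= 1 ->
  1 <= sqn (P - (zeta R)^*) -> 1 <= sqn (Q - zeta R) ->
  1 <= sqn (P + Q - zeta R) -> 1 <= sqn (P + Q - (zeta R)^*) ->
  0 <= far_form 1 P Q <= 1 -> False.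
Proof.
have r2 := r3_sqr R; have r0 := r3_gt0 R.
rewrite /far_form; have -> : zeta R ^+ 3 = 'i%C.
  by rewrite zeta_val !exprS expr0; apply: complexP => /=; field: r2.
rewrite zeta_val /sqn; case: P Q => [X Y] [U V] /=.
move=> h1 h2 h3 h4 h5 h6 /andP[n0 n1].
apply: (@far_core_real R (r3 R) X Y U (- V)) => //; lra.
Qed.

Lemma dot_scale x w s : dot x (vec_scale w s) = zval R w * dot x s.
Proof. by rewrite /dot /= !zval_mul; ring. Qed.

Lemma dot_add x s t : dot x (vec_add s t) = dot x s + dot x t.
Proof. by rewrite /dot /= !zval_add; ring. Qed.

Lemma dot_last x : dot x vec_last = x.2.
Proof. by rewrite /dot /= zval0 zval1; ring. Qed.

Lemma zval_zeta_exp n : zval R (zz_zeta_exp n) = zeta R ^+ n.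
Proof.
elim: n => [|n IHn]; first exact: zval1.
by rewrite /zz_zeta_exp iterS zval_mul -/(zz_zeta_exp n) IHn zval_zeta exprS.
Qed.

Lemma sqn_zeta_exp n : sqn (zeta R ^+ n) = 1.
Proof.
elim: n => [|n IHn]; first by rewrite /sqn /=; ring.
have r2 := r3_sqr R.
by rewrite exprS sqnM IHn zeta_val /sqn /=; field: r2.
Qed.

Lemma zeta_conj : zeta R ^+ 11 = (zeta R)^*.
Proof.
apply: (mulfI (zeta_neq0 R)); rewrite -exprS zeta12 conj_zeta.
by rewrite divff ?zeta_neq0.
Qed.

Lemma hev_scale k H x : hev (herm_scale k H) x = rval R k * hev H x.
Proof.
rewrite /hev; cbn [herm_scale h11 h22 h33 h12 h13 h23].
rewrite !rval_mul !zval_mul !zval_rz /cross.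
case: x => [[[x1 y1] [x2 y2]] [x3 y3]].
move: (zval _ (h12 H)) (zval _ (h13 H)) (zval _ (h23 H)) => [? ?] [? ?] [? ?].
by rewrite /=; ring.
Qed.

Lemma hev_far A B x :
  hev (far_herm vec_last A B) x = far_form x.2 (dot x A) (dot x B).
Proof.
rewrite /far_herm !(hev_add, hev_scale) !hev_outer !dot_add dot_last.
rewrite dot_scale zval_zeta_exp /far_form.
have -> : rval R (Zneg 2, Zneg 2) = - 2 - 2 * r3 R.
  by rewrite /rval (_ : zr R (Zneg 2) = - 2) //; ring.
have -> : rval R (Zneg 1, Zneg 1) = - 1 - r3 R.
  by rewrite /rval (_ : zr R (Zneg 1) = - 1) //; ring.
have -> : rval R (Zpos 1, Zneg 1) = 1 - r3 R.
  by rewrite /rval (_ : zr R (Zneg 1) = - 1) // zr1; ring.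
rewrite zr1 zr2; move: (sqn _) (sqn _) (sqn _) (sqn _) => p q s t; ring.
Qed.

Lemma far_homogeneous (t A B : C) : 0 < sqn t ->
  0 <= far_form t A B <= sqn t -> sqn A <= sqn t -> sqn B <= sqn t ->
  [\/ sqn (A - zeta R ^+ 11 * t) < sqn t, sqn (B - zeta R * t) < sqn t,
      sqn (A + B - zeta R * t) < sqn t | sqn (A + B - zeta R ^+ 11 * t) < sqn t].
Proof.
move=> t0 /andP[n0 n1] hA hB; rewrite zeta_conj.
have tn0 : t != 0 by apply: contraTneq t0 => ->; rewrite /sqn /= expr0n addr0 ltxx.
pose P := A / t; pose Q := B / t.
have AE : A = P * t by rewrite mulfVK. have BE : B = Q * t by rewrite mulfVK.
clearbody P Q.
have fE : far_form t A B = far_form 1 P Q * sqn t.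
  rewrite /far_form (_ : A + B + t = (P + Q + 1) * t); last by rewrite AE BE; ring.
  rewrite (_ : A + B = (P + Q) * t); last by rewrite AE BE; ring.
  rewrite (_ : _ * A + B = (zeta R ^+ 3 * P + Q) * t); last by rewrite AE BE; ring.
  by rewrite !sqnM (_ : sqn 1 = 1) /sqn /=; ring.
move: n0 n1 hA hB; rewrite fE AE BE !sqnM => n0 n1 hA hB.
have le1 p : (p * sqn t <= sqn t) = (p <= 1) by rewrite -{2}[sqn t]mul1r ler_pM2r.
rewrite (_ : P * t + Q * t = (P + Q) * t); last by ring.
rewrite -!mulrBl !sqnM.
have lt1 p : (p * sqn t < sqn t) = (p < 1) by rewrite -{2}[sqn t]mul1r ltr_pM2r.
rewrite !lt1; rewrite pmulr_lge0 // in n0; rewrite !le1 in n1 hA hB.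
have [|h1] := ltP (sqn (P - (zeta R)^*)) 1; first by constructor 1.
have [|h2] := ltP (sqn (Q - zeta R)) 1; first by constructor 2.
have [|h3] := ltP (sqn (P + Q - zeta R)) 1; first by constructor 3.
have [|h4] := ltP (sqn (P + Q - (zeta R)^*)) 1; first by constructor 4.
by case: (far_core hA hB h1 h2 h3 h4); rewrite n0 n1.
Qed.

(** By [far_ok], 2 N(x) is the value of [far_form], so that 0 < 2 N(x) <= |x_3|^2 supplies the
    bounds which [far_homogeneous] needs. *)
Lemma far_neighbour_sound x i s t cs : (i, (s, t), cs) \in far_data ->
  0 < dual_norm x -> 2 * dual_norm x <= sqn x.2 ->
  sqn (dot x (neighbour (0, 0)%N)) <= sqn x.2 ->
  sqn (dot x (neighbour i)) <= sqn x.2 ->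
  exists2 c, c \in cs & sqn (dot x (neighbour c)) < sqn x.2.
Proof.
move=> /far_data_ok; cbv beta iota zeta delta [far_ok].
move=> [st cs4 c0 c1 [c2 c3 fE]] x0 x1 h0 hi.
have /andP[hs ht] : (sqn (dot x (neighbour s)) <= sqn x.2) &&
    (sqn (dot x (neighbour t)) <= sqn x.2).
  by case: st => [] [-> ->]; rewrite h0 hi.
have nE : 2 * dual_norm x = far_form x.2 (dot x (far_A s)) (dot x (far_B t)).
  have /(congr1 (fun H => hev H x)) := fE.
  by rewrite hev_far hev_add hev_dual zr1 => <-; ring.
clear fE.
have hA : sqn (dot x (far_A s)) <= sqn x.2.
  by rewrite /far_A dot_scale zval_zeta_exp sqnM sqn_zeta_exp mul1r.
have hB : sqn (dot x (far_B t)) <= sqn x.2.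
  by rewrite /far_B dot_scale zval_zeta_exp sqnM sqn_zeta_exp mul1r.
move: (far_A s) (far_B t) c0 c1 c2 c3 nE hA hB => A B c0 c1 c2 c3 nE hA hB.
have scaleE n y : sqn (dot x (vec_scale (zz_zeta_exp n) y)) = sqn (dot x y).
  by rewrite dot_scale zval_zeta_exp sqnM sqn_zeta_exp mul1r.
have minusE n : dot x (vec_scale (zz_opp (zz_zeta_exp n)) vec_last) =
    - (zeta R ^+ n * x.2).
  by rewrite dot_scale zval_opp zval_zeta_exp dot_last mulNr.
have mem_cs k : (k < 4)%N -> nth (0, 0)%N cs k \in cs by rewrite -cs4; apply: mem_nth.
have [] := far_homogeneous _ _ hA hB.
- by apply: lt_le_trans x1; lra.
- by rewrite -nE x1 andbT; lra.
- exists (nth (0, 0)%N cs 0); first exact: mem_cs.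
  by rewrite c0 scaleE dot_add minusE.
- exists (nth (0, 0)%N cs 1); first exact: mem_cs.
  by rewrite c1 scaleE dot_add minusE expr1.
- exists (nth (0, 0)%N cs 2); first exact: mem_cs.
  by rewrite c2 scaleE (dot_add x (vec_add A B)) (dot_add x A) minusE expr1.
- exists (nth (0, 0)%N cs 3); first exact: mem_cs.
  by rewrite c3 scaleE (dot_add x (vec_add A B)) (dot_add x A) minusE.
Qed.

End FarNeighbours.

(** * The neighbours that are not above a coset *)

Definition indices : seq (nat * nat) := [seq (j, n) | j <- iota 0 6, n <- iota 0 12].

Lemma mem_indices e : (e \in indices) = (e.1 < 6) && (e.2 < 12).
Proof.
case: e => j n; apply/allpairsP/andP => [[[j' n'] [h1 h2 [-> ->]]]|[h1 h2]].
  by move: h1 h2; rewrite !mem_iota.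
by exists (j, n); rewrite ?mem_iota.
Qed.

Lemma far_index_cases :
  all (fun e => (e \in far_neighbours) ==> (e \in [seq d.1.1 | d <- far_data]))
    indices.
Proof. by vm_compute. Qed.

Lemma far_data_adjacent : all (fun d => all (fun c => (c \in neighbours) &&
  adjacent (kinv (coset_word c) ++ coset_word d.1.1)) d.2) far_data.
Proof. by vm_compute. Qed.

(** Multiplying by zeta^n and restoring the last coordinate yields [neighbour (j, n)]. *)
Definition direction (j : nat) : vec :=
  let: (p, q) := nth (zz_zero, zz_zero) neighbour_base j in (p, q, zz_zero).

(** The pairs are the opposite vertices of the octahedron formed by the six directions. *)
Lemma antipodal_forms : all (fun jk =>
    herm_eqb (herm_add (outer (direction jk.1)) (Zpos 1) (outer (direction jk.2)))
      (herm_scale (Zpos 1, Zpos 1) (herm_add herm_last (Zneg 1) herm_dual)))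
  [:: (0, 5); (1, 3); (2, 4)].
Proof. by vm_compute. Qed.

Section Local.
Local Open Scope ring_scope.
Local Open Scope complex_scope.
Variable R : realType.
Local Notation C := R[i].
Implicit Types x : C * C * C.

Lemma neighbour_cases x i : 0 < dual_norm x -> 2 * dual_norm x <= sqn x.2 ->
  (forall e, (e.1 < 6)%N ->
    sqn (dot x (neighbour (0, 0)%N)) <= sqn (dot x (neighbour e))) ->
  i \in indices -> sqn (dot x (neighbour i)) <= sqn x.2 ->
  [\/ i = (0, 0)%N, i \in neighbours |
     exists c, [/\ c \in neighbours,
       adjacent (kinv (coset_word c) ++ coset_word i) &
       sqn (dot x (neighbour c)) < sqn x.2]].
Proof.
move=> x0 x1 f_min i_ind f_i.
have /allP/(_ _ i_ind)/or4P[/eqP|i_nb|i_far|i_cert] := index_cases.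
- by constructor 1.
- by constructor 2.
- constructor 3.
  have /allP/(_ _ i_ind)/implyP/(_ i_far)/mapP[[[i' [s t]] cs] d_far /= i_i'] :=
    far_index_cases.
  have f_0 := le_trans (f_min i _) f_i.
  rewrite i_i' in f_i f_0 *.
  have [|c c_cs lt_c] := far_neighbour_sound d_far x0 x1 _ f_i.
    apply: f_0; move: i_ind; rewrite mem_indices i_i'; by case/andP.
  have /allP/(_ _ d_far)/allP/(_ _ c_cs)/andP[c_nb adj] := far_data_adjacent.
  by exists c.
- case/mapP: i_cert => c c_cert i_c.
  have /allP/(_ _ c_cert) c_ok := certificates_ok.
  by have := certificate_sound c_ok x0 f_min; rewrite -i_c ltNge f_i.
Qed.

End Local.

(** * Existence of a lower neighbour *)

Section Reduction.
Local Open Scope ring_scope.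
Local Open Scope complex_scope.
Variable R : realType.
Local Notation C := R[i].
Local Notation r := (r3 R).
Implicit Types x : C * C * C.

Lemma antipodal_sum x j k : (j, k) \in [:: (0, 5); (1, 3); (2, 4)]%N ->
  sqn (dot x (direction j)) + sqn (dot x (direction k)) =
  (1 + r) * (sqn x.2 - dual_norm x).
Proof.
move=> h; have /allP/(_ _ h)/herm_eqbP/(congr1 (fun H => hev H x)) := antipodal_forms.
rewrite hev_scale !hev_add !hev_outer hev_last hev_dual /rval zr1 mul1r => ->.
by rewrite (_ : zr R (Zneg 1) = -1) // mul1r mulN1r.
Qed.

(* The six directions are the vertices of an octahedron on the Riemann sphere. *)
Lemma octahedron_identity x :
  let n j := sqn (dot x (direction j)) in
  (n 0 - n 5) ^+ 2 + (n 1 - n 3) ^+ 2 + (n 2 - n 4) ^+ 2 =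
  ((1 + r) * (sqn x.2 - dual_norm x)) ^+ 2.
Proof.
move=> n; have r2 := r3_sqr R.
have n5 : n 5 = (1 + r) * (sqn x.2 - dual_norm x) - n 0.
  by rewrite -(@antipodal_sum x 0 5) // /n addrAC subrr add0r.
have n3 : n 3 = (1 + r) * (sqn x.2 - dual_norm x) - n 1.
  by rewrite -(@antipodal_sum x 1 3) // /n addrAC subrr add0r.
have n2 : n 2 = (1 + r) * (sqn x.2 - dual_norm x) - n 4.
  by rewrite -(@antipodal_sum x 2 4) // /n addrK.
have z : (zr R 0 = 0) * (zr R 1 = 1) * (zr R (Zneg 1) = -1) by [].
have n0 : n 0 = (2 + r) * sqn x.1.2.
  rewrite /n /dot /direction /= /zval /=; rewrite !z.
  by rewrite /sqn; case: x.2 x.1.2 x.1.1 => [? ?] [? ?] [? ?] /=; field: r2.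
have n4 : n 4 = sqn x.1.1.
  rewrite /n /dot /direction /= /zval /=; rewrite !z.
  by rewrite /sqn; case: x.2 x.1.2 x.1.1 => [? ?] [? ?] [? ?] /=; field: r2.
have n1 : n 1 = sqn x.1.1 + (2 + r) * sqn x.1.2 +
    (1 + r) / 2 * cross x.1.1 x.1.2 (1 - 'i)%C.
  rewrite /n /dot /direction /= /zval /=; rewrite !z.
  by rewrite /sqn /cross; case: x.2 x.1.2 x.1.1 => [? ?] [? ?] [? ?] /=; field: r2.
rewrite n5 n3 n2 n0 n4 n1 /dual_norm /cross /sqn.
by case: x.2 x.1.2 x.1.1 => [? ?] [? ?] [? ?] /=; field: r2.
Qed.

(** If every n_j is at most s, each antipodal difference is at most 2 s - u, so u^2 <= 3 (2 s -
    u)^2. This fails for u >= 27/20 s, since 3 * 13^2 < 27^2; and 27/20 is below (1 + sqrt 3) /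
    2. *)
Lemma octahedron_bound (n0 n1 n2 n3 n4 n5 s u : R) :
  n0 + n5 = u -> n1 + n3 = u -> n2 + n4 = u ->
  (n0 - n5) ^+ 2 + (n1 - n3) ^+ 2 + (n2 - n4) ^+ 2 = u ^+ 2 ->
  (1 + r) / 2 * s <= u -> 0 < s ->
  n0 <= s -> n1 <= s -> n2 <= s -> n3 <= s -> n4 <= s -> n5 <= s -> False.
Proof.
move=> h05 h13 h24 oct u_ge s0 l0 l1 l2 l3 l4 l5.
have us : u <= 2 * s by lra.
have sq a b : a + b = u -> a <= s -> b <= s -> (a - b) ^+ 2 <= (2 * s - u) ^+ 2.
  move=> ab la lb; have la' : - (2 * s - u) <= a - b by lra.
  have lb' : a - b <= 2 * s - u by lra.
  by rewrite -subr_ge0 subr_sqr mulr_ge0 //; lra.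
have := sq _ _ h05 l0 l5; have := sq _ _ h13 l1 l3; have := sq _ _ h24 l2 l4.
have r_lb : 71 < 41 * r := r3_lb R.
have u1 : 27 / 20 * s <= u by nra.
have u2 : (27 / 20 * s) ^+ 2 <= u ^+ 2 by rewrite !expr2 ler_pM //; lra.
have u3 : (2 * s - u) ^+ 2 <= (13 / 20 * s) ^+ 2 by rewrite !expr2 ler_pM //; lra.
have s2 : 0 < s ^+ 2 by rewrite exprn_gt0.
lra.
Qed.

Lemma long_direction x : 0 < dual_norm x -> 2 * dual_norm x <= sqn x.2 ->
  exists2 j, (j < 6)%N & sqn x.2 < sqn (dot x (direction j)) < (1 + r) * sqn x.2.
Proof.
move=> x0 x1; have r2 := r3_sqr R; have r0 := r3_gt0 R.
pose n j := sqn (dot x (direction j)); pose t := (1 + r) * (sqn x.2 - dual_norm x).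
have t_lt : t < (1 + r) * sqn x.2 by rewrite /t ltr_pM2l; lra.
have n_ge j : 0 <= n j by exact: sqn_ge0.
have n05 : n 0 + n 5 = t by exact: antipodal_sum.
have n13 : n 1 + n 3 = t by exact: antipodal_sum.
have n24 : n 2 + n 4 = t by exact: antipodal_sum.
have oct : (n 0 - n 5) ^+ 2 + (n 1 - n 3) ^+ 2 + (n 2 - n 4) ^+ 2 = t ^+ 2.
  exact: octahedron_identity.
have t_ge : (1 + r) / 2 * sqn x.2 <= t by rewrite /t; nra.
have s_gt0 : 0 < sqn x.2 by lra.
have [[j j6 lt_j]|none] := EM (exists2 j, (j < 6)%N & sqn x.2 < n j).
  exists j => //; rewrite lt_j /=; apply: le_lt_trans t_lt.
  have := (n_ge 0, n_ge 1, n_ge 2, n_ge 3, n_ge 4, n_ge 5).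
  rewrite -/(n j) => -[[[[[h0 h1] h2] h3] h4] h5].
  by case: j j6 {lt_j} => [|[|[|[|[|[|]]]]]] // _; lra.
have n_le j : (j < 6)%N -> n j <= sqn x.2.
  by move=> j6; rewrite leNgt; apply/negP => lt_j; apply: none; exists j.
by have := octahedron_bound n05 n13 n24 oct t_ge s_gt0 (n_le 0 isT) (n_le 1 isT)
  (n_le 2 isT) (n_le 3 isT) (n_le 4 isT) (n_le 5 isT).
Qed.

(** As 2 - sqrt 3 = tan 15°, one has X >= cos 15° |w| for w = X + iY. With s = |w|^2 the claim is s
    + sqrt 3 - 1 < 2 X, and squaring reduces it to (s - (2 - sqrt 3)) (2 - s) > 0. *)
Lemma sector_real (X Y : R) : `|Y| <= (2 - r) * X ->
  2 - r < X ^+ 2 + Y ^+ 2 -> X ^+ 2 + Y ^+ 2 < r - 1 ->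
  (1 - X) ^+ 2 + Y ^+ 2 < 2 - r.
Proof.
have r2 := r3_sqr R; have r_lb := r3_lb R; have r_ub := r3_ub R.
move=> hY lo hi.
have X0 : 0 <= X by have := normr_ge0 Y; nra.
have Y2 : Y ^+ 2 <= (2 - r) ^+ 2 * X ^+ 2.
  by rewrite -exprMn -real_normK ?num_real // !expr2 ler_pM.
have X2 : (2 + r) * (X ^+ 2 + Y ^+ 2) <= 4 * X ^+ 2 by nra.
set s := X ^+ 2 + Y ^+ 2 in lo hi X2.
have s1 : (s + r - 1) ^+ 2 < (2 + r) * s.
  have : 0 < (s - (2 - r)) * (2 - s) by rewrite mulr_gt0 //; lra.
  nra.
have s2 : s + r - 1 < 2 * X by nra.
rewrite (_ : (1 - X) ^+ 2 + Y ^+ 2 = 1 - 2 * X + s); last by rewrite /s; ring.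
lra.
Qed.

Lemma sqn_zeta_mul n (z : C) : sqn (zeta R ^+ n * z) = sqn z.
Proof. by rewrite sqnM sqn_zeta_exp mul1r. Qed.

Lemma dot_neighbour x j n : dot x (neighbour (j, n)) =
  zeta R ^+ n * dot x (direction j) + zval R (Zz 1 1 0 (-1)) * x.2.
Proof.
rewrite /neighbour /direction [(j, n).1]/= [(j, n).2]/=.
case: (nth _ _ _) => p q; rewrite /dot [in LHS]/fst [in LHS]/snd !zval_mul.
rewrite zval_zeta_exp [in RHS]/fst [in RHS]/snd zval0; ring.
Qed.

Lemma sector_abs (s X Y : R) : s / 2 * X - - (1 / 2) * Y <= X ->
  s / 2 * X - 1 / 2 * Y <= X -> `|Y| <= (2 - s) * X.
Proof. by move=> h1 h2; rewrite ler_norml; apply/andP; split; lra. Qed.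

(** The power of zeta that maximises the real part works: comparison with the two adjacent powers
    bounds the argument by 15°. *)
Lemma sector_rotation (u : C) : exists2 n, (n < 12)%N &
  `|complex.Im (zeta R ^+ n * u)| <= (2 - r) * complex.Re (zeta R ^+ n * u).
Proof.
pose f (n : 'I_12) := complex.Re (zeta R ^+ n * u).
case: (Order.TotalTheory.arg_maxP f (isT : xpredT (ord0 : 'I_12))) => n _ n_max.
exists n => //; have r2 := r3_sqr R; have r_ub := r3_ub R.
have max m : complex.Re (zeta R ^+ m * u) <= complex.Re (zeta R ^+ n * u).
  have := n_max (inord (m %% 12)) isT; rewrite /f inordK ?ltn_mod //.
  by rewrite {2}(divn_eq m 12) exprD mulnC exprM zeta12 expr1n mul1r.
(* [11 + n] stands for n - 1 modulo 12. *)
have := max n.+1; have := max (11 + n)%N.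
rewrite exprS exprD zeta_conj -!mulrA zeta_val.
by case: (_ * u) => X Y /= h1 h2; apply: sector_abs.
Qed.

(** Along a long direction, -L / G is rotated into the 15° sector, where |1 - w|^2 < 2 - sqrt 3.
    Since |G|^2 = (2 + sqrt 3) |x_3|^2, the product is below |x_3|^2. *)
Lemma reducing_neighbour x : 0 < dual_norm x -> 2 * dual_norm x <= sqn x.2 ->
  exists2 e, e \in indices & sqn (dot x (neighbour e)) < sqn x.2.
Proof.
move=> x0 x1; have [j j6 /andP[lo hi]] := long_direction x0 x1.
have r2 := r3_sqr R; have r_ub := r3_ub R; have r0 := r3_gt0 R.
pose G := zval R (Zz 1 1 0 (-1)) * x.2; pose L := dot x (direction j).
have GE : sqn G = (2 + r) * sqn x.2.
  by rewrite sqnM sqn_zval /rval /= (_ : zr R 2 = 2) // zr1 mul1r.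
have x2 : 0 < sqn x.2 by lra.
have G0 : 0 < sqn G by rewrite GE mulr_gt0 //; lra.
have Gn0 : G != 0.
  by apply: contraTneq G0 => ->; rewrite /sqn /= expr0n addr0 ltxx.
pose u := - L / G.
have uE : sqn u * sqn G = sqn L.
  rewrite -sqnM /u mulfVK // /sqn; case: (L) => ? ? /=; ring.
have [n n12] := sector_rotation u.
have := sqn_zeta_mul n u; rewrite {1}/sqn; move E : (zeta R ^+ n * u) => w.
move=> wE h; exists (j, n); first by rewrite mem_indices j6.
have fE : dot x (neighbour (j, n)) = (1 - w) * G.
  rewrite dot_neighbour -/G -/L -E mulrBl mul1r /u -mulrA mulfVK //; ring.
rewrite fE sqnM GE.
have : sqn (1 - w) < 2 - r.
  have lo' : 1 < sqn u * (2 + r).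
    by rewrite -(ltr_pM2r x2) mul1r -mulrA -GE uE.
  have hi' : sqn u * (2 + r) < 1 + r.
    by rewrite -(ltr_pM2r x2) -mulrA -GE uE.
  have p0 : 0 < 2 + r by lra.
  have lo2 : 2 - r < sqn u by rewrite -(ltr_pM2r p0); lra.
  have hi2 : sqn u < r - 1 by rewrite -(ltr_pM2r p0); lra.
  have := sector_real h; rewrite wE => /(_ lo2 hi2).
  by rewrite /sqn; case: (w) => X Y /=; rewrite sub0r sqrrN.
move=> h1; have : sqn (1 - w) * ((2 + r) * sqn x.2) < (2 - r) * ((2 + r) * sqn x.2).
  by rewrite ltr_pM2r // -GE.
by rewrite [X in _ < X]mulrA (_ : (2 - r) * (2 + r) = 1) ?mul1r //; lra.
Qed.

End Reduction.

(** * Heights of matrices *)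

Definition o0 : 'I_3 := @Ordinal 3 0 isT.
Definition o1 : 'I_3 := @Ordinal 3 1 isT.
Definition o2 : 'I_3 := @Ordinal 3 2 isT.

Lemma sum3 (V : nmodType) (f : 'I_3 -> V) :
  (\sum_k f k = f o0 + f o1 + f o2)%R.
Proof.
rewrite !big_ord_recl big_ord0 addr0 addrA.
by congr (f _ + f _ + f _)%R; apply: val_inj.
Qed.

Lemma ord3P (P : 'I_3 -> Prop) : P o0 -> P o1 -> P o2 -> forall i, P i.
Proof.
move=> p0 p1 p2; case=> [[|[|[|//]]] h].
- by rewrite (_ : Ordinal h = o0) //; apply: val_inj.
- by rewrite (_ : Ordinal h = o1) //; apply: val_inj.
- by rewrite (_ : Ordinal h = o2) //; apply: val_inj.
Qed.

Section Matrices.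
Local Open Scope ring_scope.
Local Open Scope complex_scope.
Local Open Scope sesquilinear_scope.
Variable R : realType.
Local Notation C := R[i].
Local Notation r := (r3 R).
Local Notation U := (unitaryF R).

Lemma mul3E (A B : 'M[C]_3) i j :
  (A *m B) i j = A i o0 * B o0 j + A i o1 * B o1 j + A i o2 * B o2 j.
Proof. by rewrite mxE sum3. Qed.

Lemma tmxE (A : 'M[C]_3) i j : A^t* i j = (A j i)^*.
Proof. by rewrite !mxE. Qed.

Lemma matrix3P (A B : 'M[C]_3) :
  (forall i, [/\ A i o0 = B i o0, A i o1 = B i o1 & A i o2 = B i o2]) -> A = B.
Proof. by move=> h; apply/matrixP=> i; apply: ord3P; case: (h i). Qed.

Lemma FmxE : [/\ F_mx R o0 o0 = (- r - 1)%:C, F_mx R o0 o1 = 1, F_mx R o1 o0 = 1,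
   F_mx R o1 o1 = (1 - r)%:C & [/\ F_mx R o0 o2 = 0, F_mx R o1 o2 = 0,
   F_mx R o2 o0 = 0, F_mx R o2 o1 = 0 & F_mx R o2 o2 = 1]].
Proof.
have rE : zeta R + (zeta R)^-1 = r%:C.
  by rewrite -conj_zeta zeta_val; apply: complexP => /=; field.
rewrite /F_mx /mx3 !mxE /= rE; split=> //; apply: complexP => /=; ring.
Qed.

Lemma FinvE : [/\ Finv R o0 o0 = (1 - r)%:C, Finv R o0 o1 = -1, Finv R o1 o0 = -1,
   Finv R o1 o1 = (- r - 1)%:C & [/\ Finv R o0 o2 = 0, Finv R o1 o2 = 0,
   Finv R o2 o0 = 0, Finv R o2 o1 = 0 & Finv R o2 o2 = 1]].
Proof.
have rE : zeta R + (zeta R)^-1 = r%:C.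
  by rewrite -conj_zeta zeta_val; apply: complexP => /=; field.
rewrite /Finv /mx3 !mxE /= rE; split=> //; apply: complexP => /=; ring.
Qed.

(** The inverse of X is F^-1 X^* F, so X F^-1 X^* F = 1. *)
Lemma dual_unitary (X : U) : val X *m Finv R *m (val X)^t* = Finv R.
Proof.
have h : val X *m inv_mx (val X) = 1%:M := congr1 val (mulUV X).
have FF : F_mx R *m Finv R = 1%:M by apply: mulmx1C; apply: FinvF.
by rewrite -[LHS]mulmx1 -FF mulmxA -[_ *m F_mx R]mulmxA -[_ *m (_ *m F_mx R)]mulmxA
  (mulmxA (Finv R)) -/(inv_mx _) h mul1mx.
Qed.

Definition last_row (A : 'M[C]_3) : C * C * C := (A o2 o0, A o2 o1, A o2 o2).

Lemma dual_norm_last_row (X : U) : dual_norm (last_row (val X)) = 1.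
Proof.
have /matrixP/(_ o2 o2) := dual_unitary X.
have [f00 f01 f10 f11 [f02 f12 f20 f21 f22]] := FinvE.
rewrite !mul3E !tmxE f00 f01 f10 f11 f02 f12 f20 f21 f22.
rewrite /last_row /dual_norm /cross /sqn.
case: (val X o2 o0) (val X o2 o1) (val X o2 o2) => [a b] [c d] [e f].
move/(congr1 (@complex.Re R)) => /=; lra.
Qed.

Definition blk (a b c d : C) : 'M[C]_3 :=
  mx3 [:: [:: a; b; 0]; [:: c; d; 0]; [:: 0; 0; 1]].

Lemma blk_mul a b c d a' b' c' d' : blk a b c d *m blk a' b' c' d' =
  blk (a * a' + b * c') (a * b' + b * d') (c * a' + d * c') (c * b' + d * d').
Proof.
apply: matrix3P; apply: ord3P; rewrite !mul3E /blk /mx3 !mxE /=;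
  by split; ring.
Qed.

Lemma blk1 : blk 1 0 0 1 = 1%:M.
Proof. by apply: matrix3P; apply: ord3P; rewrite /blk /mx3 !mxE /=; split. Qed.

End Matrices.

#[local] Arguments Z.mul : simpl never.
#[local] Arguments Z.add : simpl never.
#[local] Arguments Z.sub : simpl never.
#[local] Arguments Z.opp : simpl never.

(** * Galois conjugation and the gap between heights *)

Definition rz_conj (x : rz) : rz := (x.1, Z.opp x.2).

Definition rz_cross (a b : zz) : rz :=
  let m := zz_mul a (zz_conj b) in (Z.add (Z.mul 2 (zz0 m)) (zz2 m), zz1 m).

Definition rz_dual_norm (s : vec) : rz :=
  rz_add (zz_norm s.2) (rz_opp (rz_add
    (rz_add (rz_mul (Zneg 1, Zpos 1) (zz_norm s.1.1)) (rz_cross s.1.1 s.1.2))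
    (rz_mul (Zpos 1, Zpos 1) (zz_norm s.1.2)))).

Lemma zz_norm_gal a : zz_norm (zz_gal a) = rz_conj (zz_norm a).
Proof.
by case: a => [a0 a1 a2 a3]; rewrite /rz_conj /=; congr pair; lia.
Qed.

Lemma rz_cross_gal a b : rz_cross (zz_gal a) (zz_gal b) = rz_conj (rz_cross a b).
Proof.
case: a b => [a0 a1 a2 a3] [b0 b1 b2 b3].
by rewrite /rz_cross /rz_conj /=; congr pair; lia.
Qed.

Section Eisenstein.
Local Open Scope Z_scope.

Lemma eisenstein_ge0 (a b : Z) : 0 <= a * a + a * b + b * b.
Proof.
have h : 0 <= (2 * a + b) * (2 * a + b) by apply: Z.square_nonneg.
have := Z.square_nonneg b; lia.
Qed.

Lemma eisenstein_eq0 (a b : Z) : a * a + a * b + b * b = 0 -> a = 0 /\ b = 0.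
Proof.
move=> e; have h : 0 <= (2 * a + b) * (2 * a + b) by apply: Z.square_nonneg.
have h' := Z.square_nonneg b; have b0 : b = 0 by nia.
by rewrite b0 in e *; split=> //; nia.
Qed.

Lemma zz_norm_eq0 a : (zz_norm a).1 = 0 -> a = zz_zero.
Proof.
case: a => [a0 a1 a2 a3] /= e.
have h1 := @eisenstein_ge0 a0 a2; have h2 := @eisenstein_ge0 a1 a3.
have [-> ->] : a0 = 0 /\ a2 = 0 by apply: eisenstein_eq0; lia.
by have [-> ->] : a1 = 0 /\ a3 = 0 by apply: eisenstein_eq0; lia.
Qed.

End Eisenstein.

(** The 3-adic valuations of the two sides differ in parity; this is the irrationality of sqrt 3. *)
Lemma square_3square (m n : nat) : m ^ 2 = 3 * n ^ 2 -> n = 0.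
Proof.
case: (posnP n) => // n0 e; have := congr1 (logn 3) e.
rewrite lognM ?expn_gt0 ?n0 // !lognX (pfactorK 1) // => /(congr1 odd).
by rewrite oddD !oddM.
Qed.

Section Integrality.
Local Open Scope ring_scope.
Local Open Scope complex_scope.
Local Open Scope sesquilinear_scope.
Variable R : realType.
Local Notation C := R[i].
Local Notation r := (r3 R).
Local Notation U := (unitaryF R).
Local Notation zval := (zval R).

Lemma zr_inj : injective (zr R).
Proof.
by move=> m n /eqP; rewrite /zr eqr_int => /eqP /(can_inj int_of_ZK).
Qed.

Lemma rval_eq0 x : rval R x = 0 -> x = (Z0, Z0).
Proof.
case: x => p q; rewrite /rval /= => e.
have r2 := r3_sqr R.
have e2 : zr R p ^+ 2 = 3 * zr R q ^+ 2.
  rewrite (_ : zr R p = - (zr R q * r)); last by lra.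
  by rewrite -r2; ring.
have q0 : q = Z0.
  have /(congr1 absz) : (int_of_Z p) ^+ 2 = 3 * (int_of_Z q) ^+ 2.
    apply/eqP; rewrite -(eqr_int R) intrM !rmorphXn /=; apply/eqP; exact: e2.
  rewrite abszM !abszX => /square_3square /eqP; rewrite absz_eq0 => /eqP h.
  by apply: (can_inj int_of_ZK); rewrite h.
rewrite q0 in e *; congr pair; apply: zr_inj.
by move: e; rewrite zr0 mul0r addr0.
Qed.

Lemma rval_inj : injective (rval R).
Proof.
move=> x y e; have : rval R (rz_add x (rz_opp y)) = 0.
  by rewrite rval_add rval_opp e subrr.
case: x y {e} => p q [p' q'] /rval_eq0; rewrite /rz_add /rz_opp /=.
by case=> e e'; congr pair; lia.
Qed.

Lemma zval_inj : injective zval.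
Proof.
move=> a b e; have : rval R (zz_norm (zz_add a (zz_opp b))) = 0.
  by rewrite -sqn_zval zval_add zval_opp e subrr /sqn /= expr0n addr0.
move/rval_eq0/(congr1 fst)/zz_norm_eq0.
by case: a b {e} => [????] [????] [????]; congr Zz; lia.
Qed.

Lemma Zzeta_zval (z : C) : z \in @Zzeta R -> exists a, z = zval a.
Proof.
case/asboolP=> p ->; elim/poly_ind: p => [|p c [a e]].
  by exists zz_zero; rewrite rmorph0 horner0 zval0.
exists (zz_add (zz_mul a (Zz 0 1 0 0)) (Zz (Z_of_int c) 0 0 0)).
rewrite zval_add zval_mul zval_zeta rmorphD rmorphM /= map_polyX map_polyC /=.
rewrite hornerD hornerMX hornerC e; congr (_ + _).
have -> : zval (Zz (Z_of_int c) 0 0 0) = (zr R (Z_of_int c))%:C.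
  by apply: complexP; rewrite /= ?zr0; ring.
by rewrite /zr Z_of_intK rmorph_int.
Qed.

Lemma rval_cross a b : rval R (rz_cross a b) = cross (zval a) (zval b) 1.
Proof.
have r2 := r3_sqr R; case: a b => [a0 a1 a2 a3] [b0 b1 b2 b3].
by rewrite /rz_cross /rval /cross /= !zrE zr2; field: r2.
Qed.

Lemma rval_dual_norm s : rval R (rz_dual_norm s) =
  dual_norm (zval s.1.1, zval s.1.2, zval s.2).
Proof.
rewrite /rz_dual_norm rval_add rval_opp !rval_add !rval_mul rval_cross -!sqn_zval.
rewrite /dual_norm /=; congr (_ - (_ * _ + _ + _ * _)).
  by rewrite /rval /= (_ : zr R (Zneg 1) = -1) // zr1; ring.
by rewrite /rval /= zr1; ring.
Qed.

(** By irrationality the equation holds coordinatewise in p + q sqrt 3, hence survives sqrt 3 |-> -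
    sqrt 3. The bracket is now positive definite, which bounds the conjugate height by 1. *)
Lemma gal_dual_norm s : dual_norm (zval s.1.1, zval s.1.2, zval s.2) = 1 ->
  let n a := sqn (zval (zz_gal a)) in
  n s.2 = 1 - ((r + 1) * n s.1.1 - cross (zval (zz_gal s.1.1)) (zval (zz_gal s.1.2)) 1
    + (r - 1) * n s.1.2).
Proof.
rewrite -rval_dual_norm => /esym e /=.
have {}e : rz_dual_norm s = (Zpos 1, Z0).
  by apply: rval_inj; rewrite -e /rval /= zr0 zr1; ring.
rewrite -rval_cross rz_cross_gal !sqn_zval !zz_norm_gal.
have r2 := r3_sqr R.
move: e; rewrite /rz_dual_norm.
case: (zz_norm s.2) (zz_norm s.1.1) (zz_norm s.1.2) (rz_cross _ _).
move=> p q [p1 q1] [p2 q2] [p' q']; rewrite /rz_add /rz_opp /rz_mul /rz_conj /rval /=.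
case=> /(congr1 (zr R)) e1 /(congr1 (zr R)) e2; move: e1 e2.
rewrite !zrE zr0 zr1 zr3 (_ : zr R (Zneg 1) = -1) // => e1 e2.
have e3 : r * (zr R q - (-1 * zr R q1 + 1 * zr R p1 + zr R q' +
    (1 * zr R q2 + 1 * zr R p2))) = 0.
  by rewrite e2 mulr0.
have t1 : zr R q1 * r * r = 3 * zr R q1 by rewrite -mulrA r2 mulrC.
have t2 : zr R q2 * r * r = 3 * zr R q2 by rewrite -mulrA r2 mulrC.
lra.
Qed.

Lemma dual_bracket_ge0 (s : R) (x y : C) : 1 < s -> s * s = 3 ->
  0 <= (s - 1) * sqn x + cross x y 1 + (s + 1) * sqn y.
Proof.
move=> s1 s2; rewrite addrAC; apply: binary_form_ge0; first by lra.
by rewrite /sqn /=; lra.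
Qed.

Lemma r3_gt1 : 1 < r. Proof. have := r3_lb R; lra. Qed.

Definition row_val (s : vec) : C * C * C := (zval s.1.1, zval s.1.2, zval s.2).

Lemma last_row_val (X : U) : exists s, last_row (val X) = row_val s.
Proof.
have /andP[/mxOverP oX _] := valP X.
have [a ea] := Zzeta_zval (oX o2 o0); have [b eb] := Zzeta_zval (oX o2 o1).
have [c ec] := Zzeta_zval (oX o2 o2).
by exists (a, b, c); rewrite /last_row ea eb ec.
Qed.

Definition height (A : 'M[C]_3) : R := sqn (A o2 o2).

Lemma height_form (X : U) : exists p q,
  height (val X) = zr R p + zr R q * r /\ 0 <= zr R p - zr R q * r <= 1.
Proof.
have [s sE] := last_row_val X; have dn := dual_norm_last_row X.
rewrite sE in dn; have /= := gal_dual_norm dn.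
rewrite !sqn_zval !zz_norm_gal.
exists (zz_norm s.2).1, (zz_norm s.2).2.
have hE : height (val X) = rval R (zz_norm s.2).
  by rewrite -sqn_zval; move: sE; rewrite /last_row /height => -[_ _ ->].
split; first by rewrite hE.
have gE : zr R (zz_norm s.2).1 - zr R (zz_norm s.2).2 * r =
    sqn (zval (zz_gal s.2)).
  by rewrite sqn_zval zz_norm_gal /rval /= zrN; ring.
rewrite gE sqn_ge0 /= (gal_dual_norm dn) gerBl.
set x := zval _; set y := zval _.
have := @dual_bracket_ge0 r y (- x) r3_gt1 (r3_sqr R).
rewrite /cross /sqn; case: (x) (y) => [a b] [c d] /=; lra.
Qed.

Lemma height_ge1 (X : U) : 1 <= height (val X).
Proof.
have := dual_norm_last_row X; rewrite /dual_norm => /eqP.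
rewrite subr_eq => /eqP e; rewrite /height -[val X _ _]/((last_row (val X)).2) e.
rewrite lerDl.
exact: dual_bracket_ge0 r3_gt1 (r3_sqr R).
Qed.

(* The Galois conjugate of the form is definite, so that the conjugate of a height
   p + q sqrt 3 lies in [0, 1]. *)
Lemma height_gap (X Y : U) : height (val X) < height (val Y) ->
  height (val X) + 1 <= height (val Y).
Proof.
have [p [q [-> /andP[l1 u1]]]] := height_form X.
have [p' [q' [-> /andP[l2 u2]]]] := height_form Y => lt_h.
have r1 := r3_gt1.
have [le_p|lt_p] := lerP (zr R p') (zr R p).
  (* If p' <= p, the height grows only when q' > q, and this would make p' - q' sqrt 3 negative. *)
  have [le_q|lt_q] := lerP (zr R q') (zr R q); first by exfalso; nra.
  have : zr R q + 1 <= zr R q'.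
    by move: lt_q; rewrite /zr ltr_int -[X in _ + X]/(1%:~R) -intrD ler_int lezD1.
  by move=> hq; exfalso; nra.
(* A height is 2 p minus its conjugate, and conjugates lie in [0, 1], so the heights differ by at
   least 2 - 1. *)
have : zr R p + 1 <= zr R p'.
  by move: lt_p; rewrite /zr ltr_int -[X in _ + X]/(1%:~R) -intrD ler_int lezD1.
by lra.
Qed.

(** By [height_gap], truncation preserves the strict order of heights, so that descent can use
    natural numbers. *)
Definition nheight (A : 'M[C]_3) : nat := Num.truncn (height A).

Lemma nheight_le (X Y : U) :
  (nheight (val X) <= nheight (val Y))%N = (height (val X) <= height (val Y)).
Proof.
apply/idP/idP => [|le_h]; last by apply: le_truncn.
apply: contraTT; rewrite -ltNge -ltnNge => /height_gap le_h.
rewrite /nheight truncn_gt_nat -natr1; apply: le_trans le_h; rewrite lerD2r.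
by rewrite truncn_le (le_trans ler01 (height_ge1 Y)).
Qed.

End Integrality.

(** * The stabiliser *)

Definition mat2 := (zz * zz * zz * zz)%type.

Definition mat2_mul (m m' : mat2) : mat2 :=
  let: (a, b, c, d) := m in let: (a', b', c', d') := m' in
  (zz_add (zz_mul a a') (zz_mul b c'), zz_add (zz_mul a b') (zz_mul b d'),
   zz_add (zz_mul c a') (zz_mul d c'), zz_add (zz_mul c b') (zz_mul d d')).

Definition mat2_one : mat2 := (zz_one, zz_zero, zz_zero, zz_one).

Definition u_mat : mat2 :=
  (Zz 0 (-1) 1 1, Zz 1 (-1) 0 0, Zz (-1) 0 1 1, Zz 0 1 0 (-1)).
Definition v_mat : mat2 := (Zz 0 0 0 1, zz_zero, Zz (-1) (-1) 1 1, zz_one).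

Definition kmat (s : seq bool) : mat2 :=
  foldr (fun x m => mat2_mul (if x then u_mat else v_mat) m) mat2_one s.

Definition nf_word (t : nat * nat * nat) : seq bool := coset_word t.1 ++ vword t.2.

Definition nf_all : seq (nat * nat * nat) :=
  [seq (e, m) | e <- indices, m <- iota 0 4].

Definition mat2_eqb (m m' : mat2) : bool :=
  let: (a, b, c, d) := m in let: (a', b', c', d') := m' in
  [&& zz_eqb a a', zz_eqb b b', zz_eqb c c' & zz_eqb d d'].

Lemma kmat_faithful :
  all (fun t => mat2_eqb (kmat (nf_word t)) mat2_one ==> (t == (0, 0, 0))) nf_all.
Proof. by vm_compute. Qed.

(* Minus the value of the form F on the column (a, c, 0). *)
Definition col_norm (a c : zz) : rz :=
  rz_add (rz_add (rz_mul (Zpos 1, Zpos 1) (zz_norm a)) (rz_opp (rz_cross a c)))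
    (rz_mul (Zneg 1, Zpos 1) (zz_norm c)).

Definition zrange (n : nat) : seq Z :=
  [seq Z.sub (Z.of_nat i) (Z.of_nat n) | i <- iota 0 n.*2.+1].

Definition all_box (n : nat) (bound : Z) (P : zz -> bool) : bool :=
  all (fun a0 => all (fun a1 => all (fun a2 => all (fun a3 =>
    let a := Zz a0 a1 a2 a3 in
    if Z.leb (zz_norm a).1 bound then P a else true)
  (zrange n)) (zrange n)) (zrange n)) (zrange n).

Definition kmats : seq mat2 := [seq kmat (nf_word t) | t <- nf_all].

Lemma first_columns_ok : all_box 1 2 (fun a => all_box 2 4 (fun c =>
  if rz_eqb (col_norm a c) (Zpos 1, Zpos 1) then
    has (fun m => zz_eqb a m.1.1.1 && zz_eqb c m.1.2) kmats
  else true)).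
Proof. by vm_compute. Qed.

(** Once the first column is (1, 0), an off-diagonal entry of X^* F X = F determines d from b. *)
Definition second_entry (b : zz) : zz :=
  zz_add zz_one (zz_mul (rz_zz (Zpos 1, Zpos 1)) b).

Lemma second_columns_ok : all_box 2 4 (fun b =>
  if rz_eqb (col_norm b (second_entry b)) (Zneg 1, Zpos 1) then
    has (mat2_eqb (zz_one, b, zz_zero, second_entry b)) kmats
  else true).
Proof. by vm_compute. Qed.

Definition unit_zz : seq zz := [seq zz_zeta_exp n | n <- iota 0 12].

Lemma units_ok : all_box 1 2 (fun a =>
  if rz_eqb (zz_norm a) (Zpos 1, Z0) then has (zz_eqb a) unit_zz else true).
Proof. by vm_compute. Qed.

Lemma mem_zrange n z : Z.le (Z.abs z) (Z.of_nat n) -> z \in zrange n.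
Proof.
move=> h; apply/mapP; exists (Z.to_nat (Z.add z (Z.of_nat n))); last by lia.
by rewrite mem_iota; lia.
Qed.

Section Boxes.
Local Open Scope Z_scope.

Lemma abs_le_square (x n : Z) : 0 <= n -> x * x < (n + 1) * (n + 1) -> Z.abs x <= n.
Proof. by move=> n0 h; nia. Qed.

(** As 4 (x^2 + x y + y^2) >= 3 x^2, and likewise for y, the bound confines all four coefficients to
    the box. *)
Lemma all_boxP n bound P a : all_box n bound P ->
  4 * bound < 3 * ((Z.of_nat n + 1) * (Z.of_nat n + 1)) ->
  (zz_norm a).1 <= bound -> P a.
Proof.
case: a => [a0 a1 a2 a3] all_P lt_b le_a.
have box x y : x * x + x * y + y * y <= bound -> (x \in zrange n) /\ (y \in zrange n).
  move=> h; have hx := Z.square_nonneg (x + 2 * y).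
  have hy := Z.square_nonneg (2 * x + y).
  by split; apply: mem_zrange; apply: abs_le_square; lia.
have h1 := @eisenstein_ge0 a0 a2; have h2 := @eisenstein_ge0 a1 a3.
move: le_a => /= le_a.
have [m0 m2] : (a0 \in zrange n) /\ (a2 \in zrange n) by apply: box; lia.
have [m1 m3] : (a1 \in zrange n) /\ (a3 \in zrange n) by apply: box; lia.
move: all_P => /allP/(_ _ m0)/allP/(_ _ m1)/allP/(_ _ m2)/allP/(_ _ m3) /=.
by rewrite (introT (Z.leb_spec0 _ _) le_a).
Qed.

End Boxes.

Lemma mat2_eqbP m m' : mat2_eqb m m' -> m = m'.
Proof.
case: m m' => [[[a b] c] d] [[[a' b'] c'] d'] /and4P[].
by move=> /zz_eqbP-> /zz_eqbP-> /zz_eqbP-> /zz_eqbP->.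
Qed.

Lemma has_kmats P : has P kmats -> exists s, P (kmat s).
Proof. by rewrite has_map => /hasP[t _ h]; exists (nf_word t). Qed.

Section Stabiliser.
Local Open Scope ring_scope.
Local Open Scope complex_scope.
Local Open Scope sesquilinear_scope.
Variable R : realType.
Local Notation C := R[i].
Local Notation r := (r3 R).
Local Notation zval := (zval R).

Lemma zr_le m n : zr R m <= zr R n -> Z.le m n.
Proof.
move=> le_mn; case: (Z.le_gt_cases m n) => // lt_nm.
have : 0 < zr R (Z.sub m n) by apply: zr_gt0; lia.
by rewrite zrB subr_gt0 ltNge le_mn.
Qed.

Lemma rval_col_norm a c : rval R (col_norm a c) =
  (r + 1) * sqn (zval a) - cross (zval a) (zval c) 1 + (r - 1) * sqn (zval c).
Proof.
rewrite /col_norm !rval_add rval_opp !rval_mul rval_cross -!sqn_zval.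
by rewrite /rval /= (_ : zr R (Zneg 1) = -1) // zr1; ring.
Qed.

Lemma rval_col_norm_gal a c : rval R (rz_conj (col_norm a c)) =
  - ((r - 1) * sqn (zval (zz_gal a)) + cross (zval (zz_gal a)) (zval (zz_gal c)) 1
   + (r + 1) * sqn (zval (zz_gal c))).
Proof.
have r2 := r3_sqr R.
rewrite -rval_cross rz_cross_gal !sqn_zval !zz_norm_gal /col_norm.
case: (zz_norm a) (zz_norm c) (rz_cross a c) => [p1 q1] [p2 q2] [p' q'].
rewrite /rz_add /rz_opp /rz_mul /rz_conj /rval /=.
rewrite !zrE zr1 zr3 (_ : zr R (Zneg 1) = -1) //; ring: r2.
Qed.

(** As (s - 1) (s + 1) = 2, the differences are |(s - 1) y - x|^2 and |(s + 1) x - y|^2. *)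
Lemma col_bound (s N : R) (x y : C) : 1 < s -> s * s = 3 ->
  (s + 1) * sqn x - cross x y 1 + (s - 1) * sqn y = N ->
  sqn x <= (s - 1) * N /\ sqn y <= (s + 1) * N.
Proof.
move=> s1 s2 <-; split; rewrite -subr_ge0.
  rewrite (_ : _ - _ = sqn ((s - 1)%:C * y - x)) ?sqn_ge0 //.
  by rewrite /sqn /cross; case: x y => [? ?] [? ?] /=; ring: s2.
rewrite (_ : _ - _ = sqn ((s + 1)%:C * x - y)) ?sqn_ge0 //.
by rewrite /sqn /cross; case: x y => [? ?] [? ?] /=; ring: s2.
Qed.

Lemma col_norm_bounds a c (p q : Z) : col_norm a c = (p, q) ->
  let N := rval R (p, q) in let N' := - rval R (p, Z.opp q) in
  [/\ sqn (zval a) <= (r - 1) * N, sqn (zval c) <= (r + 1) * N,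
      sqn (zval (zz_gal a)) <= (r + 1) * N' &
      sqn (zval (zz_gal c)) <= (r - 1) * N'].
Proof.
move=> e N N'; have r2 := r3_sqr R; have r1 := r3_gt1 R.
have e1 : rval R (col_norm a c) = N by rewrite e.
have e2 : - rval R (rz_conj (col_norm a c)) = N' by rewrite e.
rewrite rval_col_norm in e1; rewrite rval_col_norm_gal opprK in e2.
have [h1 h2] := col_bound r1 r2 e1.
(* Conjugation exchanges the diagonal coefficients of the form, hence the swapped arguments. *)
have [|h3 h4] := @col_bound r N' (zval (zz_gal c)) (- zval (zz_gal a)) r1 r2.
  rewrite -e2 /cross /sqn.
  by case: (zval (zz_gal a)) (zval (zz_gal c)) => [? ?] [? ?] /=; ring.
have sqnN z : sqn (- z) = sqn z by case: z => ? ?; rewrite /sqn /=; ring.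
by split=> //; rewrite -sqnN.
Qed.

Lemma zz_norm_mean a : zr R (zz_norm a).1 =
  (sqn (zval a) + sqn (zval (zz_gal a))) / 2.
Proof.
rewrite !sqn_zval zz_norm_gal /rval /= zrN; lra.
Qed.

(** Here |a|^2 <= 2 and |c|^2 <= (sqrt 3 + 1)^2, with conjugate bounds 2 and (sqrt 3 - 1)^2.
    Averaging bounds the rational parts of the norms by 2 and 4, the sizes used in the
    enumeration. *)
Lemma first_column a c : rval R (col_norm a c) = r + 1 ->
  exists s, a = (kmat s).1.1.1 /\ c = (kmat s).1.2.
Proof.
move=> e; have {}e : col_norm a c = (Zpos 1, Zpos 1).
  by apply: (@rval_inj R); rewrite e /rval /= zr1; ring.
have := col_norm_bounds e; rewrite /rval /= zr1 (_ : zr R (Zneg 1) = -1) //.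
move=> [h1 h2 h3 h4]; have r2 := r3_sqr R.
have ba : Z.le (zz_norm a).1 2.
  by apply: zr_le; rewrite zz_norm_mean zr2; nra.
have bc : Z.le (zz_norm c).1 4.
  by apply: zr_le; rewrite zz_norm_mean (_ : zr R 4 = 4) //; nra.
have := all_boxP (all_boxP first_columns_ok erefl ba) erefl bc; cbv beta.
rewrite e (_ : rz_eqb _ _ = true) // => /has_kmats[s /andP[/zz_eqbP-> /zz_eqbP->]].
by exists s.
Qed.

Lemma second_column b d : zval d = 1 + (r + 1)%:C * zval b ->
  rval R (col_norm b d) = r - 1 ->
  exists s, kmat s = (zz_one, b, zz_zero, d).
Proof.
move=> dE e; have {}dE : d = second_entry b.
  apply: (@zval_inj R); rewrite dE zval_add zval1 zval_mul zval_rz.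
  by rewrite /rval /= zr1 mul1r [r + 1]addrC.
have {}e : col_norm b d = (Zneg 1, Zpos 1).
  apply: (@rval_inj R); rewrite e /rval /= zr1 (_ : zr R (Zneg 1) = -1) //; ring.
have := col_norm_bounds e; rewrite /rval /= zr1 (_ : zr R (Zneg 1) = -1) //.
move=> [h1 h2 h3 h4]; have r2 := r3_sqr R.
have bb : Z.le (zz_norm b).1 4.
  by apply: zr_le; rewrite zz_norm_mean (_ : zr R 4 = 4) //; nra.
have := all_boxP second_columns_ok erefl bb; cbv beta.
rewrite -dE e (_ : rz_eqb _ _ = true) // => /has_kmats[s /mat2_eqbP h].
by exists s.
Qed.

Lemma norm1_unit a : sqn (zval a) = 1 -> exists n, zval a = zeta R ^+ n.
Proof.
rewrite sqn_zval => e; have {}e : zz_norm a = (Zpos 1, Z0).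
  by apply: (@rval_inj R); rewrite e /rval /= zr1 zr0; ring.
have ba : Z.le (zz_norm a).1 2 by rewrite e.
have := all_boxP units_ok erefl ba; cbv beta.
rewrite e (_ : rz_eqb _ _ = true) // has_map => /hasP[n _ /zz_eqbP->].
by exists n; rewrite zval_zeta_exp.
Qed.

End Stabiliser.

Section Group.
Local Open Scope ring_scope.
Local Open Scope complex_scope.
Local Open Scope sesquilinear_scope.
Variable R : realType.
Local Notation C := R[i].
Local Notation r := (r3 R).
Local Notation U := (unitaryF R).
Local Notation zval := (zval R).

Definition zblk (m : mat2) : 'M[C]_3 :=
  blk (zval m.1.1.1) (zval m.1.1.2) (zval m.1.2) (zval m.2).

Lemma zblk_mul m m' : zblk (mat2_mul m m') = zblk m *m zblk m'.
Proof.
case: m m' => [[[a b] c] d] [[[a' b'] c'] d'].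
by rewrite /zblk blk_mul /= !zval_add !zval_mul.
Qed.

Definition uU : U := exist _ (u_mx R) (u_mxP R).
Definition vU : U := exist _ (v_mx R) (v_mxP R).
Definition bU : U := exist _ (b_mx R) (b_mxP R).

Lemma unitaryF_mulE (X Y : U) : val (X * Y)%g = val X *m val Y.
Proof. by []. Qed.

Lemma mx3_ext (a b c d e f g h k a' b' c' d' e' f' g' h' k' : C) :
  a = a' -> b = b' -> c = c' -> d = d' -> e = e' -> f = f' -> g = g' -> h = h' ->
  k = k' -> mx3 [:: [:: a; b; c]; [:: d; e; f]; [:: g; h; k]] =
  mx3 [:: [:: a'; b'; c']; [:: d'; e'; f']; [:: g'; h'; k']].
Proof. by do 9 move=> ->. Qed.

Lemma zval_poly a0 a1 a2 a3 : zval (Zz a0 a1 a2 a3) =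
  (zr R a0)%:C + (zr R a1)%:C * zeta R + (zr R a2)%:C * zeta R ^+ 2 +
  (zr R a3)%:C * zeta R ^+ 3.
Proof.
have r2 := r3_sqr R; rewrite zeta_val !exprS expr0.
by apply: complexP => /=; field: r2.
Qed.

Lemma zrC : ((zr R 0)%:C = 0) * ((zr R 1)%:C = 1) * ((zr R (Zneg 1))%:C = -1) *
  ((zr R (Zneg 2))%:C = - 2) * ((zr R 2)%:C = 2).
Proof.
rewrite zr0 zr1 zr2 (_ : zr R (Zneg 1) = -1) // (_ : zr R (Zneg 2) = - 2) //.
by do ![split]; rewrite ?rmorphN ?rmorph_nat ?rmorph1 ?rmorph0.
Qed.

Ltac mx3_entries :=
  apply: mx3_ext; rewrite ?/zz_zero ?/zz_one ?zval_poly ?zrC; try ring.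

Lemma u_mxE : u_mx R = zblk u_mat.
Proof. rewrite /u_mx /zblk /blk /u_mat; cbn [fst snd]; mx3_entries. Qed.

Lemma v_mxE : v_mx R = zblk v_mat.
Proof. rewrite /v_mx /zblk /blk /v_mat; cbn [fst snd]; mx3_entries. Qed.

Lemma b_last_column : [/\ b_mx R o0 o2 = zval zz_zero,
  b_mx R o1 o2 = zval (Zz 0 0 (-1) (-1)) & b_mx R o2 o2 = zval (Zz 1 1 0 (-1))].
Proof.
rewrite /b_mx /mx3 !mxE /= ?/zz_zero !zval_poly !zrC.
by split; ring.
Qed.

Local Notation K := (kev uU vU).

Lemma val_kev s : val (K s) = zblk (kmat s).
Proof.
elim: s => [|x s IHs].
  by rewrite kev_nil /zblk /= zval1 zval0 blk1.
rewrite kev_cons /= zblk_mul -IHs.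
by case: x; rewrite -?u_mxE -?v_mxE.
Qed.

Lemma kev_eq s t : kmat s = kmat t -> K s = K t.
Proof. by move=> e; apply: val_inj; rewrite !val_kev e. Qed.

Lemma uU3 : (uU ^+ 3 = 1)%g.
Proof.
have : K [:: true; true; true] = K [::] by apply: kev_eq; vm_compute.
by rewrite !kev_cons kev_nil !expgS expg0.
Qed.

Lemma vU4 : (vU ^+ 4 = 1)%g.
Proof.
have : K [:: false; false; false; false] = K [::] by apply: kev_eq; vm_compute.
by rewrite !kev_cons kev_nil !expgS expg0.
Qed.

Lemma uvU : (uU * vU * uU * vU = vU * uU * vU * uU)%g.
Proof.
have : K [:: true; false; true; false] = K [:: false; true; false; true].
  by apply: kev_eq; vm_compute.
by rewrite !kev_cons kev_nil !mulg1 !mulgA.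
Qed.

Lemma blk_unitary (X : U) a b c d : val X = blk a b c d ->
  [/\ (r + 1) * sqn a - cross a c 1 + (r - 1) * sqn c = r + 1,
      a = 1 -> c = 0 -> d = 1 + (r + 1)%:C * b &
      (r + 1) * sqn b - cross b d 1 + (r - 1) * sqn d = r - 1].
Proof.
move=> XE; have /andP[_ /eqP/matrixP uX] := valP X.
have [f00 f01 f10 f11 [f02 f12 f20 f21 f22]] := FmxE R.
have [X0 X1 X2] : [/\ val X o0 o0 = a, val X o0 o1 = b & val X o0 o2 = 0].
  by rewrite XE /blk /mx3 !mxE.
have [Y0 Y1 Y2] : [/\ val X o1 o0 = c, val X o1 o1 = d & val X o1 o2 = 0].
  by rewrite XE /blk /mx3 !mxE.
have [Z0 Z1 Z2] : [/\ val X o2 o0 = 0, val X o2 o1 = 0 & val X o2 o2 = 1].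
  by rewrite XE /blk /mx3 !mxE.
split.
- have := uX o0 o0; rewrite !mul3E !tmxE f00 f01 f10 f11 f02 f12 f20 f21 f22.
  rewrite X0 Y0 Z0 /cross /sqn => /(congr1 (@complex.Re R)).
  by case: (a) (c) => [? ?] [? ?] /=; lra.
- have := uX o0 o1; rewrite !mul3E !tmxE f00 f01 f10 f11 f02 f12 f20 f21 f22.
  rewrite X0 Y0 Z0 X1 Y1 Z1 => + a1 c0; rewrite a1 c0.
  case: (b) (d) => [p q] [p' q'] e; move: (congr1 (@complex.Re R) e).
  by move: (congr1 (@complex.Im R) e) => /= e1 e2; apply: complexP => /=; lra.
- have := uX o1 o1; rewrite !mul3E !tmxE f00 f01 f10 f11 f02 f12 f20 f21 f22.
  rewrite X1 Y1 Z1 /cross /sqn => /(congr1 (@complex.Re R)).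
  by case: (b) (d) => [? ?] [? ?] /=; lra.
Qed.

(** The last column of X F^-1 X^* = F^-1 forces that of X to be (0, 0, 1) as well. *)
Lemma stabiliser_blk (X : U) : last_row (val X) = (0, 0, 1) ->
  exists m, val X = zblk m.
Proof.
case=> x20 x21 x22.
have /matrixP dX := dual_unitary X.
have [f00 f01 f10 f11 [f02 f12 f20 f21 f22]] := FinvE R.
have c1 : (1 : C)^* = 1 by apply: complexP => /=; rewrite ?oppr0.
have c0 : (0 : C)^* = 0 by apply: complexP => /=; rewrite ?oppr0.
have x02 : val X o0 o2 = 0.
  have := dX o0 o2; rewrite !mul3E !tmxE f00 f01 f10 f11 f02 f12 f20 f21 f22.
  by rewrite x20 x21 x22 c1 c0 !mulr0 !add0r !mulr1.
have x12 : val X o1 o2 = 0.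
  have := dX o1 o2; rewrite !mul3E !tmxE f00 f01 f10 f11 f02 f12 f20 f21 f22.
  by rewrite x20 x21 x22 c1 c0 !mulr0 !add0r !mulr1.
have /andP[/mxOverP oX _] := valP X.
have [a ea] := Zzeta_zval (oX o0 o0); have [b eb] := Zzeta_zval (oX o0 o1).
have [c ec] := Zzeta_zval (oX o1 o0); have [d ed] := Zzeta_zval (oX o1 o1).
exists (a, b, c, d); apply: matrix3P; apply: ord3P.
- by rewrite ea eb x02 /zblk /blk /mx3 !mxE.
- by rewrite ec ed x12 /zblk /blk /mx3 !mxE.
- by rewrite x20 x21 x22 /zblk /blk /mx3 !mxE.
Qed.

(** Some element of K shares the first column of X. Dividing by it leaves the first column (1, 0),
    and the second enumeration finds the quotient in K. *)
Lemma stabiliser (X : U) : last_row (val X) = (0, 0, 1) -> exists s, X = K s.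
Proof.
move=> /stabiliser_blk[m XE]; have [e1 _ _] := blk_unitary XE.
have [s [as_ cs]] : exists s, m.1.1.1 = (kmat s).1.1.1 /\ m.1.2 = (kmat s).1.2.
  by apply: (@first_column R); rewrite rval_col_norm.
pose Y : U := (K (kinv s) * X)%g.
have KV : K (kinv s) = (K s)^-1%g by apply: kev_inv; [exact: uU3|exact: vU4].
have YE : val Y = zblk (mat2_mul (kmat (kinv s)) m).
  by rewrite unitaryF_mulE zblk_mul -XE val_kev.
have sE : zblk (mat2_mul (kmat (kinv s)) (kmat s)) = 1%:M.
  by rewrite zblk_mul -!val_kev -unitaryF_mulE KV mulVg.
have [b [d YE']] : exists b d, val Y = zblk (zz_one, b, zz_zero, d).
  move: YE sE as_ cs; case: (kmat (kinv s)) => [[[a' b'] c'] d'].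
  case: m {XE e1} => [[[a b] c] d]; case: (kmat s) => [[[a'' b''] c''] d''].
  move=> YE /matrixP sE /= as_ cs; rewrite as_ cs in YE.
  exists (zz_add (zz_mul a' b) (zz_mul b' d)), (zz_add (zz_mul c' b) (zz_mul d' d)).
  apply: (etrans YE); rewrite /zblk; cbn [mat2_mul fst snd].
  have := sE o0 o0; have := sE o1 o0.
  rewrite /zblk /blk /mx3 !mxE; cbn [mat2_mul fst snd nth nat_of_ord o0 o1].
  by rewrite /= zval1 zval0 => -> ->.
have [_ dE nE] := blk_unitary YE'.
have [t tE] := @second_column R b d (dE (zval1 R) (zval0 R))
  (etrans (rval_col_norm R b d) nE).
have {}YE : Y = K t by apply: val_inj; rewrite val_kev tE.
by exists (s ++ t); rewrite kev_cat -YE /Y KV mulVKg.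
Qed.

End Group.

(** * The relations in Gamma *)

Definition mat3 := (vec * vec * vec)%type.

Definition mat3_row_mul (x : vec) (m : mat3) : vec :=
  let: (x1, x2, x3) := x in
  let: ((a, b, c), (d, e, f), (g, h, k)) := m in
  let dot3 p q s := zz_add (zz_add (zz_mul x1 p) (zz_mul x2 q)) (zz_mul x3 s) in
  (dot3 a d g, dot3 b e h, dot3 c f k).

Definition mat3_mul (m m' : mat3) : mat3 :=
  (mat3_row_mul m.1.1 m', mat3_row_mul m.1.2 m', mat3_row_mul m.2 m').

Definition mat3_one : mat3 :=
  ((zz_one, zz_zero, zz_zero), (zz_zero, zz_one, zz_zero), (zz_zero, zz_zero, zz_one)).

Definition mat3_scale (w : zz) (m : mat3) : mat3 :=
  (vec_scale w m.1.1, vec_scale w m.1.2, vec_scale w m.2).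

Definition mat3_of_mat2 (m : mat2) : mat3 :=
  ((m.1.1.1, m.1.1.2, zz_zero), (m.1.2, m.2, zz_zero), (zz_zero, zz_zero, zz_one)).

Definition b_mat : mat3 :=
  ((zz_one, zz_zero, zz_zero),
   (Zz 2 2 (-1) (-2), Zz (-1) (-1) 1 1, Zz 0 0 (-1) (-1)),
   (Zz 0 1 1 0, Zz (-1) 0 0 (-1), Zz 1 1 0 (-1))).

Definition generator_mat (x : generator) : mat3 :=
  match x with
  | gen_u => mat3_of_mat2 u_mat
  | gen_v => mat3_of_mat2 v_mat
  | gen_b => b_mat
  end.

(** Signs of letters are ignored, so the value is meaningful for positive words only. *)
Definition word_mat (w : word generator) : mat3 :=
  foldr (fun a m => mat3_mul (generator_mat a.1) m) mat3_one w.

Definition relators : seq (word generator * word generator) :=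
  let u := word_gen gen_u in
  let v := word_gen gen_v in
  let b := word_gen gen_b in
    [:: (word_exp u 3, [::]);
        (word_exp v 4, [::]);
        (word_exp b 3, [::]);
        (word_exp (u ++ v) 2, word_exp (v ++ u) 2);
        (v ++ b, b ++ v);
        (word_exp (b ++ u ++ v) 3, [::]);
        (word_exp (b ++ u ++ v ++ u) 2 ++ v, [::])].

Lemma relators_hold l s : List.In (l, s) relators ->
  [/\ all snd l, all snd s & exists n,
    word_mat l = mat3_scale (zz_zeta_exp n) (word_mat s)].
Proof.
(* Spelling out the twelve powers of zeta leaves closed equations for computation. *)
have ex (P : nat -> Prop) : P 0 \/ P 1 \/ P 2 \/ P 3 \/ P 4 \/ P 5 \/ P 6 \/ P 7 \/
    P 8 \/ P 9 \/ P 10 \/ P 11 -> exists n, P n.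
  by do ![case=> [h|]; first by eexists; exact: h]; move=> h; exists 11.
do ![case=> [[<- <-]|]] => //; split=> //; apply: ex; vm_compute; tauto.
Qed.

Section Relations.
Local Open Scope ring_scope.
Local Open Scope complex_scope.
Local Open Scope sesquilinear_scope.
Local Open Scope quotient_scope.
Variable R : realType.
Local Notation C := R[i].
Local Notation U := (unitaryF R).
Local Notation zval := (zval R).

Definition mat3_val (m : mat3) : 'M[C]_3 :=
  mx3 [:: [:: zval m.1.1.1.1; zval m.1.1.1.2; zval m.1.1.2];
          [:: zval m.1.2.1.1; zval m.1.2.1.2; zval m.1.2.2];
          [:: zval m.2.1.1; zval m.2.1.2; zval m.2.2]].

Lemma mat3_val_mul m m' : mat3_val (mat3_mul m m') = mat3_val m *m mat3_val m'.
Proof.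
case: m m' => [[[[a b] c] [[d e] f]] [[g h] k]].
case=> [[[[a' b'] c'] [[d' e'] f']] [[g' h'] k']].
apply: matrix3P; apply: ord3P; rewrite !mul3E /mat3_val /mx3 !mxE;
  cbn [mat3_mul mat3_row_mul fst snd nth nat_of_ord o0 o1 o2];
  rewrite !zval_add !zval_mul; split; ring.
Qed.

Lemma mat3_val_one : mat3_val mat3_one = 1%:M.
Proof.
by apply: matrix3P; apply: ord3P; rewrite /mat3_val /mx3 !mxE /= zval0 zval1.
Qed.

Lemma mat3_val_scale n m :
  mat3_val (mat3_scale (zz_zeta_exp n) m) = zeta R ^+ n *: mat3_val m.
Proof.
by apply: matrix3P; apply: ord3P; rewrite /mat3_val /mx3 !mxE;
  cbn [mat3_scale vec_scale fst snd nth nat_of_ord o0 o1 o2];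
  rewrite !zval_mul zval_zeta_exp.
Qed.

Lemma mat3_val_mat2 m : mat3_val (mat3_of_mat2 m) = zblk R m.
Proof. by rewrite /mat3_val /zblk /blk /= zval0 zval1. Qed.

Definition generator_unitary (x : generator) : U :=
  match x with gen_u => uU R | gen_v => vU R | gen_b => bU R end.

Lemma b_mxE : b_mx R = mat3_val b_mat.
Proof.
rewrite /b_mx /mat3_val /b_mat; cbn [fst snd].
by apply: mx3_ext; rewrite ?/zz_zero ?/zz_one ?zval_poly ?zrC; ring.
Qed.

Lemma val_generator x : val (generator_unitary x) = mat3_val (generator_mat x).
Proof.
case: x; rewrite /generator_mat ?mat3_val_mat2.
- exact: u_mxE.
- exact: v_mxE.
- exact: b_mxE.
Qed.

Lemma val_positive_word w : all snd w ->
  val (word_eval generator_unitary w) = mat3_val (word_mat w).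
Proof.
elim: w => [_|[x e] w IHw /andP[/= -> /IHw IH]].
  by rewrite /word_eval big_nil mat3_val_one.
by rewrite /word_eval big_cons mat3_val_mul -IH -val_generator.
Qed.

Lemma piM (X Y : U) : \pi_(Gamma R) (X * Y)%g = (\pi_(Gamma R) X * \pi_(Gamma R) Y)%g.
Proof. exact: pi_mulG. Qed.

Lemma piV (X : U) : \pi_(Gamma R) (X^-1)%g = ((\pi_(Gamma R) X)^-1)%g.
Proof. exact: pi_invG. Qed.

Lemma pi1 : \pi_(Gamma R) (1%g : U) = 1%g.
Proof. by rewrite -[RHS]/(oneG R) piE. Qed.

Lemma pi_word w :
  word_eval (generator_val R) w = \pi_(Gamma R) (word_eval generator_unitary w).
Proof.
rewrite /word_eval; elim: w => [|[x e] w IHw]; first by rewrite !big_nil pi1.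
rewrite !big_cons piM IHw; congr (_ * _)%g.
by case: e => /=; rewrite ?piV; case: x.
Qed.

Lemma pi_eqP (X Y : U) : \pi_(Gamma R) X = \pi_(Gamma R) Y <->
  exists n, val X = zeta R ^+ n *: val Y.
Proof.
split=> [/eqP|h]; first by rewrite eqmodE => /eqmodZP.
by apply/eqP; rewrite eqmodE; apply/eqmodZP.
Qed.

Lemma relators_Gamma l s : List.In (l, s) relators ->
  word_eval (generator_val R) l = word_eval (generator_val R) s.
Proof.
case/relators_hold=> l_pos s_pos [n e]; rewrite !pi_word; apply/pi_eqP.
by exists n; rewrite !val_positive_word // e mat3_val_scale.
Qed.

Lemma word_eval_cat (X : Type) (G : groupType) (gens : X -> G) w1 w2 :
  word_eval gens (w1 ++ w2) = (word_eval gens w1 * word_eval gens w2)%g.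
Proof. exact: big_cat. Qed.

Lemma word_eq_eval (X : Type) (G : groupType) (gens : X -> G) rels w1 w2 :
  (forall l s, List.In (l, s) rels -> word_eval gens l = word_eval gens s) ->
  word_eq rels w1 w2 -> word_eval gens w1 = word_eval gens w2.
Proof.
move=> hrels; elim=> //.
- move=> x e; rewrite /word_eval !big_cons big_nil mulg1.
  by case: e; rewrite /= ?mulgV ?mulVg.
- by move=> ? ? ? ? _ h1 _ h2; rewrite !word_eval_cat h1 h2.
- by move=> ? ? ? _ -> _ ->.
Qed.

End Relations.

(** * Heights in Gamma *)

Lemma neighbour_baseE : all (fun j =>
    let m := kmat (nth [::] coset_words j) in
    let: (p, q) := nth (zz_zero, zz_zero) neighbour_base j in
    zz_eqb p (zz_mul m.1.1.2 (Zz 0 0 (-1) (-1))) &&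
    zz_eqb q (zz_mul m.2 (Zz 0 0 (-1) (-1)))) (iota 0 6).
Proof. by vm_compute. Qed.

Lemma nf_coset_word : all (fun e => (nf (coset_word e)).1 == e) indices.
Proof. by vm_compute. Qed.

Lemma nf_step_index x t t' : t.1 = t'.1 -> (nf_step x t).1 = (nf_step x t').1.
Proof.
case: t t' => [[j n] m] [[j' n'] m'] /= [-> ->].
by case: (nth _ _ _) => [[k a] c].
Qed.

(** Left multiplication acts on indices, that is, on the cosets in K of the powers of v. *)
Lemma nf_cat_index s t t' : (nf t).1 = (nf t').1 -> (nf (s ++ t)).1 = (nf (s ++ t')).1.
Proof. by move=> h; elim: s => // x s IHs; apply: nf_step_index. Qed.

Lemma nf_index s : (nf s).1 \in indices.
Proof. by rewrite mem_indices; case/and3P: (nf_bound s) => -> ->. Qed.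

Lemma neighbours_indices : all (fun c => c \in indices) neighbours.
Proof. by vm_compute. Qed.

Section Heights.
Local Open Scope ring_scope.
Local Open Scope complex_scope.
Local Open Scope quotient_scope.
Variable R : realType.
Local Notation C := R[i].
Local Notation U := (unitaryF R).
Local Notation uU := (uU R).
Local Notation vU := (vU R).
Local Notation bU := (bU R).
Local Notation K := (kev uU vU).
Implicit Types (X Y : U).

Lemma vbU : commute vU bU.
Proof.
apply: val_inj.
have := @val_positive_word R [:: (gen_v, true); (gen_b, true)] isT.
have := @val_positive_word R [:: (gen_b, true); (gen_v, true)] isT.
rewrite /word_eval !big_cons big_nil; cbn [fst snd generator_unitary].
rewrite !mulg1 => e1 e2; apply: (etrans e2); apply: etrans (esym e1).
by congr mat3_val; vm_compute.
Qed.

Lemma height_mulK X s : height (val (X * K s)%g) = height (val X).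
Proof.
rewrite /height unitaryF_mulE val_kev mul3E /zblk /blk /mx3 !mxE /=.
by rewrite !mulr0 !add0r mulr1.
Qed.

Lemma height1 : height (val (1%g : U)) = 1.
Proof. by rewrite /height mxE /sqn /= expr0n addr0 expr1n. Qed.

Lemma height_mul X Y s : val Y o0 o2 = zval R s.1.1 -> val Y o1 o2 = zval R s.1.2 ->
  val Y o2 o2 = zval R s.2 -> height (val (X * Y)%g) = sqn (dot (last_row (val X)) s).
Proof. by move=> y0 y1 y2; rewrite /height unitaryF_mulE mul3E y0 y1 y2. Qed.

Lemma val_kev_central n :
  val (K (flatten (nseq n [:: true; false; true; false]))) =
  blk (zeta R ^+ n) 0 0 (zeta R ^+ n).
Proof.
elim: n => [|n IHn]; first by rewrite kev_nil expr0 blk1.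
set z := [:: true; false; true; false].
rewrite (_ : flatten (nseq n.+1 z) = z ++ flatten (nseq n z)) // /z.
rewrite kev_cat unitaryF_mulE IHn val_kev.
have -> : kmat [:: true; false; true; false] =
  (Zz 0 1 0 0, zz_zero, zz_zero, Zz 0 1 0 0) by vm_compute.
rewrite /zblk; cbn [fst snd]; rewrite zval_zeta zval0 blk_mul exprS.
by congr blk; ring.
Qed.

Lemma height_coset X e : (e.1 < 6)%N ->
  height (val (X * (K (coset_word e) * bU))%g) =
  sqn (dot (last_row (val X)) (neighbour e)).
Proof.
case: e => j n j6; have /(allP neighbour_baseE) : j \in iota 0 6 by rewrite mem_iota.
rewrite /coset_word /neighbour kev_cat; cbn [fst snd].
case: (nth _ neighbour_base j) => p q /andP[/zz_eqbP pE /zz_eqbP qE].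
have [b0 b1 b2] := b_last_column R.
apply: height_mul; rewrite !unitaryF_mulE val_kev val_kev_central /zblk blk_mul mul3E.
all: rewrite b0 b1 b2 ?zval_mul ?zval_zeta_exp ?pE ?qE ?zval_mul ?zval0.
all: by rewrite /blk /mx3 !mxE; cbn [fst snd nth nat_of_ord o0 o1 o2]; ring.
Qed.

(** The trailing power of v in the normal form passes through b into K and leaves the height
    unchanged. *)
Lemma height_neighbour X s : height (val (X * K s * bU)%g) =
  sqn (dot (last_row (val X)) (neighbour (nf s).1)).
Proof.
have s6 : ((nf s).1.1 < 6)%N by case/and3P: (nf_bound s).
rewrite -height_coset // (nfP (uU3 R) (vU4 R) (uvU R)) kev_coset_word /nf_val.
cbn [fst snd]; rewrite (expg0 vU) mulg1.
move: (kev _ _ _ * _)%g => k.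
have -> : (X * (k * vU ^+ (nf s).2) * bU = X * (k * bU) * K (vword (nf s).2))%g.
  by rewrite kev_vword -!mulgA (commute_sym (commuteX _ (commute_sym vbU))).
exact: height_mulK.
Qed.

Definition gamma_height (g : Gamma R) : nat := nheight (val (repr g)).

Lemma gamma_height_pi X : gamma_height (\pi X) = nheight (val X).
Proof.
have /pi_eqP[n e] : \pi_(Gamma R) (repr (\pi_(Gamma R) X)) = \pi X by rewrite reprK.
rewrite /gamma_height /nheight e /height mxE.
by rewrite sqnM sqn_zeta_exp mul1r.
Qed.

Lemma pi_kev s : \pi_(Gamma R) (K s) = kev (gamma_u R) (gamma_v R) s.
Proof.
elim: s => [|x s IHs]; first by rewrite !kev_nil pi1.
by rewrite !kev_cons piM IHs; case: x.
Qed.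

Lemma nheight_lt X Y :
  (nheight (val X) < nheight (val Y))%N = (height (val X) < height (val Y)).
Proof. by rewrite ltnNge nheight_le -ltNge. Qed.

Lemma height_dual X : 1 < height (val X) ->
  0 < dual_norm (last_row (val X)) /\
  2 * dual_norm (last_row (val X)) <= sqn (last_row (val X)).2.
Proof.
rewrite -height1 => /height_gap; rewrite height1 dual_norm_last_row.
by move=> h; rewrite mulr1; split; [exact: ltr01|exact: h].
Qed.

(** All neighbours of K have height |1 + zeta - zeta^3|^2 = 2 + sqrt 3. *)
Lemma height_up s : 1 < height (val (K s * bU)%g).
Proof.
rewrite -[K s]mul1g height_neighbour.
have -> : dot (last_row (val (1%g : U))) (neighbour (nf s).1) = zval R (Zz 1 1 0 (-1)).
  rewrite /dot /last_row /neighbour; case: (nth _ _ _) => p q.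
  by rewrite !mxE; cbn [fst snd]; rewrite /= mulr1n !mulr0n !mul0r !add0r mul1r.
rewrite sqn_zval /rval /= zr1 (_ : zr R 2 = 2) //.
by have := r3_gt0 R; lra.
Qed.

Lemma sqn_le0 (z : C) : sqn z <= 0 -> z = 0.
Proof.
case: z => a b; rewrite /sqn /= => h.
by apply: complexP => /=; nra.
Qed.

(** Times sqrt 3 - 1, the bracket is |(sqrt 3 - 1) x + y|^2 + |y|^2. *)
Lemma dual_bracket_le0 (x y : C) :
  (r3 R - 1) * sqn x + cross x y 1 + (r3 R + 1) * sqn y <= 0 -> x = 0 /\ y = 0.
Proof.
have r2 := r3_sqr R; have r1 := r3_gt1 R => h.
have y0 : y = 0.
  apply: sqn_le0; have : (r3 R - 1) * ((r3 R - 1) * sqn x + cross x y 1 +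
    (r3 R + 1) * sqn y) <= 0 by rewrite pmulr_rle0 // subr_gt0.
  apply: le_trans; rewrite -subr_ge0.
  rewrite (_ : _ - _ = sqn ((r3 R - 1)%:C * x + y)) ?sqn_ge0 //.
  by rewrite /sqn /cross; case: (x) (y) => [? ?] [? ?] /=; ring: r2.
split=> //; apply: sqn_le0; rewrite y0 in h.
have : (r3 R - 1) * sqn x <= 0.
  by move: h; rewrite /cross /sqn; case: (x) => [? ?] /=; lra.
by rewrite pmulr_rle0 // subr_gt0.
Qed.

Lemma zeta_scale_unitary (A : 'M[C]_3) n :
  unitaryF_pred A -> unitaryF_pred (zeta R ^+ n *: A).
Proof.
move=> uA; elim: n => [|n]; first by rewrite expr0 scale1r.
rewrite exprS -scalerA; move: (_ *: A) => {uA}A /andP[/mxOverP oA /eqP uA].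
apply/andP; split.
  by apply/mxOverP => i j; rewrite mxE rpredM ?zeta_Zzeta.
have -> : ((zeta R *: A)^t* = Num.conj (zeta R) *: A^t*)%sesqui.
  by apply/matrixP => i j; rewrite !mxE rmorphM.
rewrite -scalemxAr -!scalemxAl scalerA uA conjC_zeta -zetaV.
by rewrite divff ?scale1r ?zeta_neq0.
Qed.

(** The bracket in the dual norm vanishes, so the last row is (0, 0, zeta^n); scaling by zeta^-n,
    with [11 * n] for - n, leads to [stabiliser]. *)
Lemma height_le1 X : height (val X) <= 1 ->
  exists s, \pi_(Gamma R) X = \pi_(Gamma R) (K s).
Proof.
move=> hX; have := dual_norm_last_row X; have [t tE] := last_row_val X.
rewrite /dual_norm => dn.
have [x0 x1] : (last_row (val X)).1.1 = 0 /\ (last_row (val X)).1.2 = 0.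
  by apply: dual_bracket_le0; move: hX dn; rewrite /height /last_row; cbn [fst snd]; lra.
have n1 : sqn (zval R t.2) = 1.
  have s0 : sqn (0 : C) = 0 by rewrite /sqn /= expr0n addr0.
  have c0 : cross (0 : C) 0 1 = 0 by rewrite /cross /=; ring.
  by move: dn; rewrite x0 x1 s0 c0 !mulr0 !addr0 subr0 tE.
have [n nE] := norm1_unit n1.
pose Y : U := exist (@unitaryF_pred R) _ (zeta_scale_unitary (11 * n) (valP X)).
have XY : \pi_(Gamma R) Y = \pi_(Gamma R) X by apply/pi_eqP; exists (11 * n)%N.
rewrite -XY; have [|s ->] := @stabiliser R Y; last by exists s.
move: x0 x1 (congr1 snd tE); rewrite /last_row /row_val; cbn [fst snd].
move=> x0 x1 x2; rewrite !mxE x0 x1 x2 nE !mulr0 -exprD -mulSnr exprM zeta12 expr1n.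
by [].
Qed.

End Heights.

(** * The isomorphism *)

HB.instance Definition _ := gen_eqMixin generator.
HB.instance Definition _ := gen_choiceMixin generator.

(** * Generation of Gamma by u, v and b *)

Section Surjectivity.
Local Open Scope ring_scope.
Local Open Scope complex_scope.
Local Open Scope quotient_scope.
Variable R : realType.
Local Notation val_word := (word_eval (generator_val R)).

Lemma word_eval_inv (X : choiceType) (G : groupType) (gens : X -> G) w :
  word_eval gens (word_inv w) = (word_eval gens w)^-1%g.
Proof.
apply: (@mulIg _ (word_eval gens w)); rewrite mulVg -word_eval_cat.
(* The cancellation is taken in the free group, presented by no relations. *)
by rewrite (word_eq_eval _ (word_invl [::] w)) // /word_eval big_nil.
Qed.

Definition kword (s : seq bool) : word generator :=
  [seq (if x then gen_u else gen_v, true) | x : bool <- s].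

Lemma val_kword s : val_word (kword s) = kev (gamma_u R) (gamma_v R) s.
Proof.
rewrite /word_eval /kword big_map; apply: eq_bigr => x _.
by case: x.
Qed.

(** Induction on the height: above 1 there is a lower neighbour, and height 1 means membership in
    K. *)
Lemma word_val_surjective (g : Gamma R) : exists w, val_word w = g.
Proof.
have [n] := ubnP (gamma_height g); elim: n g => // n IHn g.
rewrite -[g]reprK; move: (repr g) => X {g}; rewrite gamma_height_pi ltnS => le_n.
have [le1|/height_dual[d0 d2]] := lerP (height (val X)) 1.
  by have [s ->] := height_le1 le1; exists (kword s); rewrite val_kword pi_kev.
have [e e_ind lt_e] := reducing_neighbour d0 d2.
have e6 : (e.1 < 6)%N by move: e_ind; rewrite mem_indices => /andP[].
pose k := kev (uU R) (vU R) (coset_word e).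
have [|w wE] := IHn (\pi_(Gamma R) (X * (k * bU R))%g).
  rewrite gamma_height_pi; apply: leq_trans le_n.
  by rewrite nheight_lt height_coset.
exists (w ++ word_inv (kword (coset_word e) ++ word_gen gen_b)).
have bE : val_word (word_gen gen_b) = \pi_(Gamma R) (bU R).
  by rewrite /word_eval big_seq1.
rewrite word_eval_cat word_eval_inv word_eval_cat wE val_kword -pi_kev -/k bE.
by rewrite -piM -piV -piM mulgK.
Qed.

End Surjectivity.

(** * Descent in the presented group *)

Section Injectivity.
Variable R : realType.
Local Notation U := (unitaryF R).
Local Notation val_word := (word_eval (generator_val R)).
Local Notation P := (presented relators).
Local Notation cl := (@word_class generator relators).
Local Open Scope group_scope.
Local Open Scope quotient_scope.

Lemma class_exp w n : cl (word_exp w n) = cl w ^+ n.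
Proof.
elim: n => [|n IHn]; first by rewrite class_one expg0.
by rewrite expgS -IHn -class_mul.
Qed.

Lemma relator_class l s : List.In (l, s) relators -> cl l = cl s.
Proof. by move=> h; apply/word_classP/word_eq_rel. Qed.

Let u : P := cl (word_gen gen_u).
Let v : P := cl (word_gen gen_v).
Let b : P := cl (word_gen gen_b).
Local Notation K := (kev u v).
Local Notation KU := (kev (uU R) (vU R)).

Let u3 : u ^+ 3 = 1.
Proof. by rewrite -class_exp -class_one; apply: relator_class; left. Qed.
Let v4 : v ^+ 4 = 1.
Proof. by rewrite -class_exp -class_one; apply: relator_class; do 1!right; left. Qed.
Let b3 : b ^+ 3 = 1.
Proof. by rewrite -class_exp -class_one; apply: relator_class; do 2!right; left. Qed.
Let uv_braid : u * v * u * v = v * u * v * u.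
Proof.
have : cl (word_exp (word_gen gen_u ++ word_gen gen_v) 2) =
    cl (word_exp (word_gen gen_v ++ word_gen gen_u) 2).
  by apply: relator_class; do 3!right; left.
by rewrite !class_exp !class_mul !expg2 !mulgA.
Qed.
Let vb : commute v b.
Proof.
have : cl (word_gen gen_v ++ word_gen gen_b) = cl (word_gen gen_b ++ word_gen gen_v).
  by apply: relator_class; do 4!right; left.
by rewrite !class_mul.
Qed.
Let buv3 : (b * u * v) ^+ 3 = 1.
Proof.
rewrite -class_one -[RHS](relator_class (l := word_exp
  (word_gen gen_b ++ word_gen gen_u ++ word_gen gen_v) 3)); last by do 5!right; left.
by rewrite class_exp !class_mul mulgA.
Qed.
Let buvu2 : (b * u * v * u) ^+ 2 * v = 1.
Proof.
rewrite -class_one -[RHS](relator_class (l := word_exp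
  (word_gen gen_b ++ word_gen gen_u ++ word_gen gen_v ++ word_gen gen_u) 2 ++
  word_gen gen_v)); last by do 6!right; left.
by rewrite class_mul class_exp !class_mul !mulgA.
Qed.

(** The natural homomorphism to Gamma; independence of the representative is [psi_class]. *)
Let psi (g : P) : Gamma R := val_word (repr g).

Let psi_class w : psi (cl w) = val_word w.
Proof. exact: word_eq_eval (@relators_Gamma R) (class_repr _ w). Qed.

Let psiM g h : psi (g * h) = psi g * psi h.
Proof. by rewrite -[g]repr_class -[h]repr_class -class_mul !psi_class word_eval_cat. Qed.

Let psi_gen x : psi (cl (word_gen x)) = \pi_(Gamma R) (generator_unitary R x).
Proof. by rewrite psi_class /word_eval big_seq1; case: x. Qed.

Let psi_K s : psi (K s) = \pi_(Gamma R) (KU s).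
Proof.
elim: s => [|x s IHs].
  by rewrite !kev_nil pi1 -class_one psi_class /word_eval big_nil.
rewrite !kev_cons psiM IHs piM; congr (_ * _).
by case: x; rewrite psi_gen.
Qed.

Let ht (g : P) : nat := gamma_height (psi g).

Let psi_repr g : exists X : U, psi g = \pi_(Gamma R) X.
Proof. by exists (repr (psi g)); rewrite reprK. Qed.

Let htE g X : psi g = \pi_(Gamma R) X -> ht g = nheight (val X).
Proof. by rewrite /ht => ->; apply: gamma_height_pi. Qed.

Let ht_KE g X s : psi g = \pi_(Gamma R) X -> ht (g * K s) = nheight (val (X * KU s)).
Proof. by move=> gX; apply: htE; rewrite psiM gX psi_K piM. Qed.

Let ht_KbE g X s : psi g = \pi_(Gamma R) X ->
  ht (g * K s * b) = nheight (val (X * KU s * bU R)).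
Proof. by move=> gX; apply: htE; rewrite !psiM gX psi_K psi_gen !piM. Qed.

Let psi1 : psi 1 = \pi_(Gamma R) (1 : U).
Proof. by rewrite -(kev_nil u v) psi_K kev_nil. Qed.

Let htK g s : ht (g * K s) = ht g.
Proof.
have [X gX] := psi_repr g.
by rewrite (ht_KE _ gX) (htE gX) /nheight height_mulK.
Qed.

Let ht_up s : (ht 1 < ht (K s * b)).
Proof.
rewrite -[K s]mul1g (ht_KbE _ psi1) (htE psi1) nheight_lt height1 mul1g.
exact: height_up.
Qed.

Let ht_local g : (ht 1 < ht g) ->
  (forall s, (ht (g * b) <= ht (g * K s * b))) ->
  forall s, (ht (g * K s * b) <= ht g) ->
  [\/ (nf s).1 = (0, 0), adjacent s
     | exists t, [/\ adjacent t, adjacent (kinv t ++ s) &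
         (ht (g * K t * b) < ht g)]].
Proof.
have [X gX] := psi_repr g.
rewrite (htE psi1) (htE gX) nheight_lt height1 => /height_dual[d0 d2] g_min s.
rewrite (ht_KbE _ gX) nheight_le height_neighbour => le_s.
have [||e0|e_nb|[c [c_nb adj lt_c]]] :=
    @neighbour_cases R (last_row (val X)) (nf s).1 d0 d2 _ (nf_index s).
- move=> e e6; rewrite -(height_coset _ e6) -[(0, 0)]/(nf [::]).1 -height_neighbour.
  rewrite mulgA -nheight_le -!(ht_KbE _ gX) kev_nil mulg1; exact: g_min.
- exact: le_s.
- by constructor 1.
- by constructor 2.
- constructor 3; have c_ind := allP neighbours_indices _ c_nb.
  have cE : (nf (coset_word c)).1 = c by apply/eqP/(allP nf_coset_word).
  exists (coset_word c); rewrite (ht_KbE _ gX) nheight_lt height_neighbour cE.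
  split=> //; first by rewrite /adjacent cE.
  rewrite /adjacent (@nf_cat_index _ _ (coset_word (nf s).1)) //.
  exact/esym/eqP/(allP nf_coset_word)/nf_index.
Qed.

Lemma word_val_kernel w : val_word w = 1 -> word_eq relators w [::].
Proof.
move=> w1; apply/word_classP.
have gensE x : [\/ cl (word_gen x) = u, cl (word_gen x) = v | cl (word_gen x) = b].
  by case: x; [constructor 1|constructor 2|constructor 3].
have := descending_word u3 v4 b3 uv_braid vb buv3 buvu2 htK ht_up ht_local w gensE.
rewrite word_eval_class => /(descending_stab htK).
have psi_w : psi (cl w) = \pi_(Gamma R) (1 : U) by rewrite psi_class w1 pi1.
(* A trivial image has the height of 1, so the word represents an element of K. *)
rewrite (htE psi_w) (htE psi1) => /(_ (leqnn _))[s sE].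
have kE : K s = K (nf_word (nf s)).
  rewrite kev_cat kev_vword (nfP u3 v4 uv_braid) (kev_coset_word u v).
  by rewrite /nf_val /= mulg1.
have := psi_K (nf_word (nf s)); rewrite -kE -sE psi_w => /esym/pi_eqP[n].
rewrite val_kev => /matrixP e.
(* The corner entry of elements of K is 1, which removes the ambiguity by scalars. *)
have n1 : (zeta R ^+ n = 1)%R.
  by have := e o2 o2; rewrite /zblk /blk /mx3 !mxE /= mulr1n mulr1.
have f_s : mat2_eqb (kmat (nf_word (nf s))) mat2_one.
  move: e; rewrite n1; case: (kmat _) => [[[p q] p'] q'] e.
  have h i j := e i j.
  move: (h o0 o0) (h o0 o1) (h o1 o0) (h o1 o1).
  rewrite /zblk /blk /mx3 !mxE; cbn [fst snd nth nat_of_ord o0 o1 o2].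
  rewrite !mulr1n !mulr0n !mulr1 !mulr0.
  rewrite -!(zval1 R) -!(zval0 R) => /zval_inj-> /zval_inj-> /zval_inj-> /zval_inj->.
  by vm_compute.
have /(allP kmat_faithful)/implyP/(_ f_s)/eqP s0 : nf s \in nf_all.
  have /and3P[h1 h2 h3] := nf_bound s; case E : (nf s) h1 h2 h3 => [e' m] h1 h2 h3.
  by apply/allpairsP; exists (e', m); rewrite mem_indices h1 h2 mem_iota.
by rewrite sE kE s0 class_one /nf_word /= kev_nil.
Qed.

Lemma word_val_inj w1 w2 : val_word w1 = val_word w2 -> word_eq relators w1 w2.
Proof.
move=> e; have := @word_val_kernel (w1 ++ word_inv w2).
rewrite word_eval_cat word_eval_inv e mulgV => /(_ erefl)/word_classP.
rewrite class_mul => h; apply/word_classP.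
apply: (@mulIg _ (cl (word_inv w2))); rewrite h -class_mul.
exact/esym/word_classP/word_invr.
Qed.

End Injectivity.

Theorem proposition3p3 (R : realType) :
  let u := word_gen gen_u in
  let v := word_gen gen_v in
  let b := word_gen gen_b in
  is_presentation (generator_val R)
    [:: (word_exp u 3, [::]);
        (word_exp v 4, [::]);
        (word_exp b 3, [::]);
        (word_exp (u ++ v) 2, word_exp (v ++ u) 2);
        (v ++ b, b ++ v);
        (word_exp (b ++ u ++ v) 3, [::]);
        (word_exp (b ++ u ++ v ++ u) 2 ++ v, [::])].
Proof.
move=> u v b; split=> [g|w1 w2]; first exact: word_val_surjective.
split; first exact: word_val_inj.
exact: word_eq_eval (@relators_Gamma R).
Qed.
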